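(* Let $T$ be a locally finite connected rooted tree with edge set $E$, let $1<p<\infty$ with $p^*=p/(p-1)$, and let $\pi:E\to[0,\infty)$ be a non-negative weight on the edges. Then for a positive Borel measure $\mu$ on $\overline{T}$ the following are equivalent. (i) The two-weight Hardy inequality holds: the best constant $[\mu]\in[0,\infty]$ in $$\int_{\overline{T}}\Big(\sum_{\alpha\in[o^*,x]}\varphi(\alpha)\Big)^p d\mu(x)\le [\mu]\sum_{\alpha\in E}\varphi(\alpha)^p\pi(\alpha)\qquad\text{for all }\varphi:E\to[0,\infty)$$ is finite. (ii) The mass-energy condition holds: $$[[\mu]]^{p^*-1}:=\sup_{\alpha\in E}\frac{1}{\mu(S(\alpha))}\sum_{\beta\subseteq\alpha}\pi(\beta)^{1-p^*}\mu(S(\beta))^{p^*}<\infty.$$ (iii) The isocapacitary condition holds: $$[[\mu]]_c:=\sup_{\alpha_1,\dots,\alpha_n\in E} \frac{\sum_{i=1}^n\mu(S(\alpha_i))}{\mathrm{Cap}_{p,\pi}\big(\bigcup_{i=1}^nS(\alpha_i)\big)}<\infty,$$ where the supremum is over all $n\ge1$ and all finite families $\alpha_1,\dots,\alpha_n\in E$ for which the sets $S(\alpha_1),\dots,S(\alpha_n)$ are pairwise disjoint. Furthermore, the following inequalities hold: $$[[\mu]]_c\le[\mu]\le 2^p\,[[\mu]]_c,\qquad [[\mu]]\le[\mu]\le p^{p^*}\,[[\mu]].$$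
   Context: Tree setting. $T$ is a simple connected graph without cycles, with finite or countable vertex set, in which every vertex has finitely many neighbours; $E$ is its set of edges. A root vertex $o$ is fixed, together with an auxiliary pre-root vertex $o^*$ which is joined to $o$ (by the root edge $\omega\in E$) and to no other vertex. $T$ also denotes the set of vertices other than $o^*$. For vertices $x,y$, $[x,y]$ is the set of edges of the unique geodesic joining them. $\partial T$ is the set of maximal geodesics starting at $o^*$; if $T$ is infinite all of these are assumed infinite, and if $T$ is finite a maximal geodesic is identified with the leaf at which it ends. For $x\in\partial T$, $[o^*,x]$ is the set of edges of the geodesic $x$. Put $\overline{T}=T\cup\partial T$ and, for $\alpha\in E$, $S(\alpha)=\{x\in\overline{T}:\alpha\in[o^*,x]\}$. $\overline{T}$ carries the (compact) topology generated by the sets $S(\alpha)$, $\alpha\in E$, and the singletons $\{x\}$, $x\in T$. For an edge $\beta$, $e(\beta)$ is its endpoint farthest from $o^*$, and for edges $\beta\subseteq\alpha$ means $\alpha\in[o^*,e(\beta)]$. Capacity. For a closed set $A\subseteq\overline{T}$, $$\mathrm{Cap}_{p,\pi}(A)=\inf\Big\{\sum_{\alpha\in E}\varphi(\alpha)^p\pi(\alpha):\ \varphi:E\to[0,\infty),\ \sum_{\alpha\in[o^*,x]}\varphi(\alpha)\ge1\ \text{for all }x\in A\Big\}.$$ Conventions: $0^{1-p^*}=+\infty$, $0\cdot\infty=0$, $0/0=0$, and $c/0=+\infty$ for $c>0$.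
   Formalization: The last inequality is proved as [μ] ≤ p^p [[μ]] instead of [μ] ≤ p^{p*} [[μ]], which is false for p > 2 (for p ≤ 2 the proved bound is at least as strong); for measures of infinite mass the convention ∞/∞ = +∞ is added. *)

(* Defs.v *)
From HB Require Import structures.
From mathcomp Require Import all_boot all_order all_algebra finmap.
From mathcomp Require Import all_classical all_reals all_analysis.

Set Implicit Arguments.
Unset Strict Implicit.
Unset Printing Implicit Defensive.
Import Order.TTheory GRing.Theory Num.Theory.
Import numFieldNormedType.Exports.

Local Open Scope classical_set_scope.
Local Open Scope ring_scope.
Local Open Scope ereal_scope.

(* [x :: s] is a geodesic of the graph [adj], i.e. a shortest walk between its
   endpoints [x] and [last x s]. *)
Definition geodesic (V : eqType) (adj : rel V) (x : V) (s : seq V) : Prop :=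
  path adj x s /\
  forall s', path adj x s' -> last x s' = last x s -> (size s <= size s')%N.

(* The whole graph, including the pre-root [prer] (denoted o^* below). The
   vertices of T proper are the vertices other than [prer].
   A cycle is a closed walk through at least three distinct vertices. *)
Record rootedTree := RootedTree {
  vert : countType;
  adj : rel vert;
  prer : vert;
  root : vert;
  adj_sym : symmetric adj;
  adj_irr : irreflexive adj;
  adj_connected : forall x y, exists2 s, path adj x s & last x s = y;
  adj_acyclic : forall c, (2 < size c)%N -> ~~ ucycleb adj c;
  adj_locally_finite : forall x, finite_set [set y | adj x y];
  adj_prer : forall y, adj prer y = (y == root);
  (* in an infinite tree no finite geodesic starting at o^* is maximal *)
  maximal_geodesic_infinite : infinite_set [set: vert] ->
    forall s, geodesic adj prer s -> exists y, geodesic adj prer (rcons s y)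
}.

Section Tree.
Variable G : rootedTree.
Local Notation V := (vert G).

Definition edges : set {fset V} :=
  [set a | exists x y, adj x y /\ a = [fset x; y]%fset].

Definition path_edges (x : V) (s : seq V) : set {fset V} :=
  [set a | exists2 q, q \in zip (x :: s) s & a = [fset q.1; q.2]%fset].

(* The set of edges [x, y]. *)
Definition geo_edges (x y : V) : set {fset V} :=
  [set a | exists s,
    [/\ geodesic (@adj G) x s, last x s = y & path_edges x s a]].

Definition dist (x y : V) : nat :=
  xget 0%N [set n | exists s,
    [/\ geodesic (@adj G) x s, last x s = y & size s = n]].

(* The endpoint e(b) of the edge b. *)
Definition far_end (b : {fset V}) : V :=
  xget (prer G) [set z | z \in b /\
    forall w, w \in b -> (dist (prer G) w <= dist (prer G) z)%N].

(* [edge_sub b a] is the relation b ⊆ a between edges. *)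
Definition edge_sub (b a : {fset V}) : Prop :=
  geo_edges (prer G) (far_end b) a.

Definition is_ray (g : nat -> V) : Prop :=
  g 0%N = prer G /\
  forall n, geodesic (@adj G) (prer G) (mkseq (fun i => g i.+1) n).

(* T ∪ ∂T. If T is infinite, every maximal geodesic from o^* is infinite, so
   ∂T is the set of rays. If T is finite, there are no rays, and ∂T is
   identified with a set of leaves, hence is already contained in the first
   summand. *)
Definition Tbar : Type := ({x : V | x != prer G} + {g : nat -> V | is_ray g})%type.

Definition geo_to (x : Tbar) : set {fset V} :=
  match x with
  | inl v => geo_edges (prer G) (sval v)
  | inr g => range (fun n => [fset sval g n; sval g n.+1]%fset)
  end.

Definition shadow (a : {fset V}) : set Tbar := [set x | geo_to x a].

Lemma root_neq_prer : root G != prer G.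
Proof.
apply/eqP => h; have := adj_irr (prer G).
by rewrite adj_prer h eqxx.
Qed.

HB.instance Definition _ := gen_eqMixin Tbar.
HB.instance Definition _ := gen_choiceMixin Tbar.
HB.instance Definition _ := isPointed.Build Tbar
  (inl (exist (fun x => is_true (x != prer G)) (root G) root_neq_prer)).

Definition Tbar_subbase : set (set Tbar) :=
  [set A | (exists2 a, edges a & A = shadow a) \/
           (exists v, A = [set (inl v : Tbar)])].

HB.instance Definition _ :=
  isSubBaseTopological.Build Tbar Tbar_subbase (fun A : set Tbar => A).

(* [Tbar] with its Borel sigma-algebra. *)
Definition borel_Tbar := g_sigma_algebraType (@open Tbar).

Variables (R : realType) (p : R) (pi : {fset V} -> R).

(* The exponent p^*. *)
Definition pconj : R := (p / (p - 1))%R.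

(* Functions on the set of edges are represented by functions on {fset V}, of
   which only the values on [edges] matter. *)
Definition nonneg_on_edges (phi : {fset V} -> R) : Prop :=
  forall a, edges a -> (0 <= phi a)%R.

Definition hardy_op (phi : {fset V} -> R) (x : Tbar) : \bar R :=
  \esum_(a in geo_to x) (phi a)%:E.

Definition energy (phi : {fset V} -> R) : \bar R :=
  \esum_(a in edges) ((phi a `^ p)%R * pi a)%:E.

Definition capacity (A : set Tbar) : \bar R :=
  ereal_inf [set energy phi | phi in
    [set phi | nonneg_on_edges phi /\ forall x, A x -> 1 <= hardy_op phi x]].

(* Quotient of elements of [0, +oo]: c/0 = +oo for c > 0, 0/0 = 0, c/+oo = 0 for
   c < +oo, and +oo/c = +oo for all c. The case +oo/+oo = +oo occurs only for
   measures of infinite total mass, where [mass_energy_sup] must be +oo because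
   p^* > 1. *)
Definition equot (a b : \bar R) : \bar R := if a == +oo then +oo else a / b.

(* t^(1-p^* ) for t >= 0, with value +oo at t = 0, where powR would give 0. *)
Definition dual_weight (t : R) : \bar R :=
  if t == 0%R then +oo else (t `^ (1 - pconj))%:E.

Variable mu : {measure set borel_Tbar -> \bar R}.

(* The best constant [mu] of the Hardy inequality; +oo if no real constant is
   admissible. *)
Definition hardy_const : \bar R :=
  ereal_inf [set C%:E | C in [set C : R | (0 <= C)%R /\
    forall phi, nonneg_on_edges phi ->
      \int[mu]_x (hardy_op phi x `^ p) <= C%:E * energy phi]].

Definition mass_energy_sup : \bar R :=
  ereal_sup [set equot
      (\esum_(b in [set b | edges b /\ edge_sub b a])
         (dual_weight (pi b) * mu (shadow b) `^ pconj))
      (mu (shadow a)) | a in edges].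

(* The constant [[mu]], determined by [[mu]]^(p^* - 1) = mass_energy_sup. *)
Definition mass_energy_const : \bar R :=
  mass_energy_sup `^ ((pconj - 1)^-1)%R.

(* The constant [[mu]]_c. *)
Definition isocapacitary_const : \bar R :=
  ereal_sup [set r | exists n (a : 'I_n.+1 -> {fset V}),
    [/\ forall i, edges (a i),
        trivIset [set: 'I_n.+1] (fun i => shadow (a i)) &
        r = equot (\sum_(i < n.+1) mu (shadow (a i)))
                  (capacity (\bigcup_(i in [set: 'I_n.+1]) shadow (a i)))]].

End Tree.

(* Main.v *)
Require Import Defs.
From mathcomp Require Import all_boot all_order all_algebra finmap.
From mathcomp Require Import all_classical all_reals all_analysis.
From mathcomp Require Import measurable_realfun ring lra.

(** Both equivalences come with explicit constants, and the proofs rest on two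
remarks. Write [q] for the exponent conjugate to [p], [I phi (x)] for the sum of
[phi] along the geodesic of [x], [S a] for the shadow of the edge [a], and
[E phi] for the energy.

Only finite families [F] of edges matter: exhausting the edges and using
monotone convergence, it suffices to treat functions [phi] carried by [F]
(lemma [hardy_admissible_limit]). For such [phi] let [v a] and [u a] be the sums
of [phi] over the edges of [F] weakly, respectively strictly, above [a]. The
edges of [F] on one geodesic form a chain along which each [v] is the next [u],
so the increments [f (v a) - f (u a)] telescope to [f (I phi (x)) - f 0].
Integrating, for nondecreasing [f] with [f 0 = 0],
[int f (I phi) dmu = sum_a (f (v a) - f (u a)) mu (S a)]
(lemma [integral_path_sum]), and every integral becomes a finite sum.

The only inequality about powers is Young's, in its tangent-line form
[p a y^(p-1) <= a^p + (p-1) y^p] (lemma [powR_tangent]).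

The mass-energy condition. Let [X = int (I phi)^p dmu] and
[s a = pi(a)^(1-q) mu(S a)^q]. Convexity gives
[X <= p sum phi v^(p-1) mu(S)], and Young's inequality with a parameter [l]
bounds this by [l^(p-1) E phi + (p-1) l^(-1) sum s v^p]. If the sum of [s] below
every edge [c] is at most [K mu(S c)], then telescoping [v^p] and exchanging the
sums yields [sum s v^p <= K X] (lemma [carleson]). The choice [l = p K] leaves
[X / p <= (p K)^(p-1) E phi], that is the constant [p^p K^(p-1)]. Conversely,
the Hardy inequality tested on [phi = (mu(S) / pi)^(q-1)], carried by edges
below [c], returns the mass-energy condition at [c] (lemma [mass_energy_le]).

The isocapacitary condition. It follows from the Hardy inequality because a test
function for the capacity of a set has [I phi >= 1] there. Conversely, the set
where [I phi > t] is a disjoint union of shadows, those of the edges at which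
[I phi] crosses [t], and its capacity is tested on the increments of
[min (I phi, t)^2 / t^2]. This quadratic profile gives the constant [2^p]:
its density [2 s / t^2] at the height [s < t] satisfies
[int_s^oo p t^(p-1) (2 s / t^2)^p dt = 2^p]. To remain with finite sums, the
integral over [t] is replaced by a sum over geometric levels [eps r^k]
(lemma [capacitary_level_sum]). This costs an error [eps^p mu(T)] and turns
[2^p] into [(1+r)^p]; both losses disappear in the limit [eps -> 0], [r -> 1].

A measure of infinite mass violates each of the three conditions, as one sees at
the root edge, so that all masses are finite in the estimates above. *)

Set Implicit Arguments.
Unset Strict Implicit.
Unset Printing Implicit Defensive.

Import Order.TTheory GRing.Theory Num.Theory.
Local Open Scope classical_set_scope.

(** * Geodesics from the pre-root *)

Section TreeGeometry.
Variable G : rootedTree.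
Local Notation V := (vert G).
Local Notation o := (prer G).

Lemma rev_path_adj (x z : V) (r : seq V) :
  path (@adj G) x (rcons r z) -> path (@adj G) z (rcons (rev r) x).
Proof.
move=> h; have := rev_path (@adj G) x (rcons r z).
rewrite last_rcons belast_rcons rev_cons => ->.
by apply: sub_path h => a b; rewrite /= adj_sym.
Qed.

(** Two simple walks that part and meet again would enclose a cycle. *)
Lemma simple_path_unique (s s' : seq V) (x : V) :
  path (@adj G) x s -> path (@adj G) x s' ->
  uniq (x :: s) -> uniq (x :: s') -> last x s = last x s' -> s = s'.
Proof.
elim: s s' x => [|y t IH] [|y' t'] x //=.
- by move=> _ _ _ /andP[xn _] e; move: xn; rewrite e mem_last.
- by move=> _ _ /andP[xn _] _ e; move: xn; rewrite -e mem_last.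
move=> /andP[xy pt] /andP[xy' pt'] /andP[xn u] /andP[xn' u'] e.
have [eyy|nyy] := eqVneq y y'.
  by subst y'; congr (_ :: _); exact: IH e.
exfalso.
have hz : has (mem (y' :: t')) (y :: t).
  by apply/hasP; exists (last y t); rewrite ?mem_last// inE e; exact: mem_last.
(* z is the first vertex of the first walk that lies on the second one *)
have [z [s1 [s2 [zs' ns1 Es]]]] : exists z s1 s2,
    [/\ z \in y' :: t', ~~ has (mem (y' :: t')) s1 & y :: t = s1 ++ z :: s2].
  case: (split_find hz) => z s1 s2 zs' ns1.
  by exists z, s1, s2; rewrite cat_rcons.
have [r1 [r2 Er]] : exists r1 r2, y' :: t' = r1 ++ z :: r2.
  by case/splitPr: zs' => r1 r2; exists r1, r2.
have ps : path (@adj G) x (y :: t) by rewrite /= xy.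
have pr : path (@adj G) x (y' :: t') by rewrite /= xy'.
have us : uniq (x :: y :: t) by rewrite cons_uniq xn.
have ur : uniq (x :: y' :: t') by rewrite cons_uniq xn'.
move: ps us; rewrite Es => ps us.
rewrite Er in ns1 zs' pr ur.
(* the cycle goes to z along the first walk and comes back along the second *)
have := @adj_acyclic G (x :: s1 ++ z :: rev r1).
suff -> : ucycleb (@adj G) (x :: s1 ++ z :: rev r1).
  move=> /(_ _)/negP[]//; rewrite /= size_cat /= size_rev !addnS !ltnS.
  case: s1 Es {ns1 ps us} => [[yz _]|//]; case: r1 Er {zs' pr ur} => [[yz' _]|//].
  by rewrite yz yz' eqxx in nyy.
apply/andP; split.
  rewrite /= rcons_cat cat_path /= .
  move: ps; rewrite cat_path /= => /and3P[-> -> _] /=.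
  by apply: rev_path_adj; move: pr; rewrite -cat_rcons cat_path => /andP[].
have us1 : uniq (x :: rcons s1 z).
  by move: us; rewrite -cat_rcons -cat_cons cat_uniq => /and3P[].
have ur1 : uniq (x :: rcons r1 z).
  by move: ur; rewrite -cat_rcons -cat_cons cat_uniq => /and3P[].
rewrite -cat_rcons -cat_cons cat_uniq us1 rev_uniq.
move: ur1; rewrite cons_uniq rcons_uniq => /and3P[xr1 zr1 ->]; rewrite andbT.
apply/hasPn => w; rewrite mem_rev => wr1.
rewrite inE mem_rcons inE !negb_or; apply/and3P; split.
- by apply: contraNneq xr1 => <-; rewrite mem_rcons inE wr1 orbT.
- by apply: contraNneq zr1 => <-.
- by apply: contra ns1 => ws1; apply/hasP; exists w => //; rewrite inE mem_cat wr1.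
Qed.

(** The geodesic from the pre-root to [v], without its starting point. *)
Definition stem (v : V) : seq V := shorten o (s2val (cid2 (adj_connected o v))).

Lemma stemP v :
  [/\ path (@adj G) o (stem v), uniq (o :: stem v) & last o (stem v) = v].
Proof.
rewrite /stem; case: cid2 => /= s ps; case/shortenP: ps => s' ps' us' _ es.
by split.
Qed.

Lemma stem_last s :
  path (@adj G) o s -> uniq (o :: s) -> stem (last o s) = s.
Proof.
by move=> ps us; have [p1 u1 l1] := stemP (last o s); apply: simple_path_unique l1.
Qed.

Lemma size_stem_le s : path (@adj G) o s -> (size (stem (last o s)) <= size s)%N.
Proof.
move=> ps; have [s' ps' us' sub] := shortenP ps.
by rewrite stem_last//; apply: uniq_leq_size => //; case/andP: us'.
Qed.

(** A shortest walk has no repetition, and in a tree a walk without repetition is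
    determined by its ends. *)
Lemma geodesic_stem s v : geodesic (@adj G) o s /\ last o s = v <-> s = stem v.
Proof.
split=> [[[ps min] <-]|->].
  suff us : uniq (o :: s) by rewrite stem_last.
  have [s' [ps' us' es' sub]] : exists s', [/\ path (@adj G) o s',
      uniq (o :: s'), last o s' = last o s & {subset s' <= s}].
    by case: (shortenP ps) => s' *; exists s'.
  apply: (leq_size_uniq us'); last by rewrite /= ltnS min.
  by move=> w; rewrite !inE => /orP[->//|/sub ->]; rewrite orbT.
have [p1 _ l1] := stemP v; split=> //; split=> // s' ps'.
by rewrite l1 => <-; exact: size_stem_le.
Qed.

Lemma dist_stem v : dist o v = size (stem v).
Proof.
rewrite /dist; set A := (X in xget _ X).
have hA : A (size (stem v)).
  by exists (stem v); have [] := (geodesic_stem (stem v) v).2 erefl.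
have [s [gs ls <-]] := xgetI 0%N hA.
by rewrite ((geodesic_stem s v).1 (conj gs ls)).
Qed.

Definition parent (w : V) : V := last o (take (size (stem w)).-1 (stem w)).

(** Every edge is [edge_above w] for exactly one vertex [w], its far end. Through
    this parametrization the inclusion order of edges becomes membership in stems. *)
Definition edge_above (w : V) : {fset V} := [fset parent w; w]%fset.

Lemma parent_rcons s w : path (@adj G) o (rcons s w) -> uniq (o :: rcons s w) ->
  parent w = last o s.
Proof.
move=> /stem_last h /h; rewrite last_rcons /parent => ->.
by rewrite size_rcons /= -cats1 take_size_cat.
Qed.

Lemma path_edges_rcons (x : V) s w a :
  path_edges x (rcons s w) a <-> path_edges x s a \/ a = [fset last x s; w]%fset.
Proof.
have zE : zip (x :: rcons s w) (rcons s w) = rcons (zip (x :: s) s) (last x s, w).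
  by elim: s x => [|y t iht] x //=; rewrite -iht.
rewrite /path_edges /= zE; split=> [[q]|[[q qs ->]|->]].
- by rewrite mem_rcons inE => /orP[/eqP -> ->|qs ->]; [right|left; exists q].
- by exists q => //; rewrite mem_rcons inE qs orbT.
- by exists (last x s, w); rewrite ?mem_rcons ?mem_head.
Qed.

Lemma path_edgesE s a : path (@adj G) o s -> uniq (o :: s) ->
  path_edges o s a <-> exists2 w, w \in s & a = edge_above w.
Proof.
elim/last_ind: s => [|s w IH]; first by split=> [[q]|[w]]; rewrite ?in_nil.
move=> p u.
have ps : path (@adj G) o s by move: p; rewrite rcons_path => /andP[].
have us : uniq (o :: s) by move: u; rewrite -rcons_cons rcons_uniq => /andP[].
have ew : edge_above w = [fset last o s; w]%fset by rewrite /edge_above (parent_rcons p u).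
rewrite path_edges_rcons IH// -ew; split=> [[[z zs ->]|->]|[z]].
- by exists z => //; rewrite mem_rcons inE zs orbT.
- by exists w => //; rewrite mem_rcons mem_head.
- by rewrite mem_rcons inE => /orP[/eqP -> ->|zs ->]; [right|left; exists z].
Qed.

Lemma geo_edgesE v a :
  geo_edges o v a <-> exists2 w, w \in stem v & a = edge_above w.
Proof.
have [p u l] := stemP v; rewrite -path_edgesE//; split=> [[s [gs ls]]|h].
  by rewrite ((geodesic_stem s v).1 (conj gs ls)).
by exists (stem v); have [] := (geodesic_stem (stem v) v).2 erefl.
Qed.

Lemma stem_nil v : v != o -> stem v = rcons (take (size (stem v)).-1 (stem v)) v.
Proof.
have [_ _ l] := stemP v; move: l; case/lastP: (stem v) => [/= <-|s w].
  by rewrite eqxx.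
by rewrite last_rcons => -> _; rewrite size_rcons /= -cats1 take_size_cat// cats1.
Qed.

Lemma mem_stem_self v : v != o -> v \in stem v.
Proof. by move=> /stem_nil ->; rewrite mem_rcons mem_head. Qed.

Lemma stem_prer : stem o = [::].
Proof. exact: (@stem_last [::]). Qed.

Lemma mem_stem_neq v w : w \in stem v -> w != o.
Proof.
by have [_ /= /andP[h _] _] := stemP v => wv; apply: contraNneq h => <-.
Qed.

Lemma stem_prefix v w : w \in o :: stem v -> exists t, stem v = stem w ++ t.
Proof.
have [p u _] := stemP v; move: p u => + + wv.
case/splitPl: wv => p1 p2 <-.
rewrite cat_path -cat_cons cat_uniq => /andP[p _] /andP[u _].
by rewrite stem_last//; exists p2.
Qed.

Lemma stem_subset v w : w \in stem v -> {subset stem w <= stem v}.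
Proof.
move=> wv; have [|t ->] := @stem_prefix v w; first by rewrite inE wv orbT.
by move=> z; rewrite mem_cat => ->.
Qed.

(** The stems of [w] and [w'] are both prefixes of that of [v]. If neither
    contained the end of the other, each would be shorter than the other. *)
Lemma stem_total v w w' :
  w \in stem v -> w' \in stem v -> w \in stem w' \/ w' \in stem w.
Proof.
move=> wv wv'; have [|t et] := @stem_prefix v w; first by rewrite inE wv orbT.
move: (wv'); rewrite et mem_cat => /orP[|w't]; [by right|left].
have [|t' et'] := @stem_prefix v w'; first by rewrite inE wv' orbT.
move: (wv); rewrite et' mem_cat => /orP[//|wt'].
have w0 := mem_stem_self (mem_stem_neq wv); have w0' := mem_stem_self (mem_stem_neq wv').
have [_ + _] := stemP v; rewrite cons_uniq => /andP[_ u].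
have uw : w' \notin stem w.
  by move: u; rewrite et cat_uniq => /and3P[_ /hasPn h _]; exact: h.
have uw' : w \notin stem w'.
  by move: u; rewrite et' cat_uniq => /and3P[_ /hasPn h _]; exact: h.
have := congr1 (fun s => (index w s, index w' s)) (etrans (esym et) et').
rewrite /= !index_cat w0 w0' (negbTE uw) (negbTE uw') => -[e1 e2].
have h1 : (index w (stem w) < size (stem w))%N by rewrite index_mem.
have h2 : (index w' (stem w') < size (stem w'))%N by rewrite index_mem.
have : (size (stem w') < size (stem w))%N.
  by apply: leq_ltn_trans h1; rewrite e1 leq_addr.
move=> h3; have : (size (stem w) < size (stem w'))%N.
  by apply: leq_ltn_trans h2; rewrite -e2 leq_addr.
by move=> h4; have := ltn_trans h3 h4; rewrite ltnn.
Qed.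

Lemma stem_anti w w' : w \in stem w' -> w' \in stem w -> w = w'.
Proof.
move=> h h'; have [|t et] := @stem_prefix w' w; first by rewrite inE h orbT.
have [|t' et'] := @stem_prefix w w'; first by rewrite inE h' orbT.
have [_ _ <-] := stemP w; have [_ _ <-] := stemP w'.
suff t0 : t = [::] by rewrite et t0 cats0.
apply: size0nil; have := congr1 size et; rewrite {}et' !size_cat.
by move/eqP; rewrite -addnA -[X in X == _]addn0 eqn_add2l eq_sym addn_eq0 => /andP[_ /eqP].
Qed.

(** If [y] is not on the stem of [x], appending it gives a simple walk; if it is,
    the part of the stem up to [y], followed by [x], is one. *)
Lemma adj_stem x y : adj x y -> stem y = rcons (stem x) y \/ stem x = rcons (stem y) x.
Proof.
move=> xy; have [p u l] := stemP x.
have [yx|nyx] := boolP (y \in o :: stem x); last first.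
  left; rewrite -{1}(last_rcons o (stem x) y) stem_last//.
    by rewrite rcons_path p l.
  by rewrite -rcons_cons rcons_uniq nyx.
right; have [t et] := stem_prefix yx.
have [p' u' l'] := stemP y.
have nxy : x \notin o :: stem y.
  case: t et => [|z t] et.
    by move: l l' xy; rewrite et cats0 => -> ->; rewrite adj_irr.
  move: u; rewrite et -cat_cons cat_uniq => /and3P[_ /hasPn h _].
  by apply: h; rewrite -[X in X \in _]l et last_cat /= mem_last.
rewrite -{1}(last_rcons o (stem y) x) stem_last//.
  by rewrite rcons_path p' l' adj_sym.
by rewrite -rcons_cons rcons_uniq nxy.
Qed.

Lemma edge_above_adj w z : w != o -> stem w = rcons (stem z) w ->
  edge_above w = [fset z; w]%fset.
Proof.
move=> wo e; rewrite /edge_above /parent e size_rcons /= -cats1 take_size_cat//.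
by have [_ _ ->] := stemP z.
Qed.

Lemma parent_stem w : w != o -> stem w = rcons (stem (parent w)) w.
Proof.
move=> wo; have := stem_nil wo; rewrite /parent.
set s := take _ _ => e; have [p u _] := stemP w.
rewrite e rcons_path in p; rewrite e -rcons_cons rcons_uniq in u.
by rewrite stem_last//; [case/andP: p|case/andP: u].
Qed.

Lemma edgesE a : edges a <-> exists2 w, w != o & a = edge_above w.
Proof.
split=> [[x [y [xy ->]]]|[w wo ->]].
  have neq z z' : stem z = rcons (stem z') z -> z != o.
    by move=> e; apply/eqP => z0; move: e; rewrite z0 stem_prer; case: (stem z').
  have [e|e] := adj_stem xy; [exists y|exists x]; rewrite ?(neq _ _ e)//.
    by rewrite (edge_above_adj _ e)// (neq _ _ e).
  by rewrite (edge_above_adj _ e) ?(neq _ _ e)// fsetUC.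
exists (parent w), w; split=> //.
have [p _ _] := stemP w; have [_ _ l] := stemP (parent w).
by move: p; rewrite (parent_stem wo) rcons_path l => /andP[].
Qed.

Lemma far_end_above w : w != o -> far_end (edge_above w) = w.
Proof.
move=> wo; rewrite /far_end; set A := (X in xget _ X).
have lt : (dist o (parent w) < dist o w)%N.
  by rewrite !dist_stem (parent_stem wo) size_rcons.
have Aw : A w.
  split; first by rewrite !inE eqxx orbT.
  by move=> z; rewrite !inE => /orP[/eqP ->|/eqP ->//]; exact: ltnW.
have [+ hz] := xgetI o Aw; set z := xget _ _ in hz *; rewrite !inE => /orP[/eqP zp|/eqP//].
by have := hz w; rewrite !inE eqxx orbT zp leqNgt lt => /(_ isT).
Qed.

Lemma edge_sub_above w a : w != o ->
  edge_sub (edge_above w) a <-> exists2 z, z \in stem w & a = edge_above z.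
Proof. by move=> wo; rewrite /edge_sub far_end_above// geo_edgesE. Qed.

Lemma edge_above_inj w z : w != o -> z != o -> edge_above w = edge_above z -> w = z.
Proof. by move=> wo zo e; rewrite -(far_end_above wo) e far_end_above. Qed.

Lemma ray_stem (g : nat -> V) n : is_ray g -> stem (g n) = mkseq (fun i => g i.+1) n.
Proof.
move=> [g0 gg]; apply/esym/geodesic_stem; split; first exact: gg.
by case: n => [|n]; rewrite ?mkseqS ?last_rcons.
Qed.

Lemma ray_stemE (g : nat -> V) n w : is_ray g ->
  w \in stem (g n) <-> exists2 i, (i < n)%N & w = g i.+1.
Proof.
move=> rg; rewrite ray_stem//; split=> [/mapP[i]|[i lin ->]].
  by rewrite mem_iota add0n => /andP[_ ?] ->; exists i.
by apply/mapP; exists i => //; rewrite mem_iota.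
Qed.

Lemma geo_to_ray (g : nat -> V) (rg : is_ray g) a :
  geo_to (inr (exist _ g rg)) a <-> exists n, geo_edges o (g n) a.
Proof.
have gneq n : g n.+1 != o.
  by apply: (@mem_stem_neq (g n.+1)); apply/ray_stemE => //; exists n.
have gE n : edge_above (g n.+1) = [fset g n; g n.+1]%fset.
  by apply: edge_above_adj => //; rewrite !ray_stem// mkseqS.
split=> [[n _ /= <-]|[n]].
  exists n.+1; apply/geo_edgesE; exists (g n.+1); last by rewrite gE.
  exact: mem_stem_self.
move=> /geo_edgesE[w /(ray_stemE _ _ rg)[i _ ->] ->].
by exists i => //=; rewrite gE.
Qed.

Lemma geo_edges_ray_le (g : nat -> V) (m n : nat) a : is_ray g -> (m <= n)%N ->
  geo_edges o (g m) a -> geo_edges o (g n) a.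
Proof.
move=> rg mn /geo_edgesE[w /(ray_stemE _ _ rg)[i im ->] ->].
apply/geo_edgesE; exists (g i.+1) => //; apply/ray_stemE => //.
by exists i => //; exact: leq_trans mn.
Qed.

(** Two edges of a ray already lie on a finite initial part of it, so statements
    about pairs of edges need only be checked on stems of vertices. *)
Lemma geo_to_vertex (x : Tbar G) a b : geo_to x a -> geo_to x b ->
  exists v, [/\ v != o, geo_edges o v a & geo_edges o v b].
Proof.
case: x => [[v vo]|[g rg]] /=; first by exists v.
move=> /(geo_to_ray rg)[m ma] /(geo_to_ray rg)[n nb].
have h k c : geo_edges o (g k) c -> geo_edges o (g (maxn (maxn m n) k).+1) c.
  by apply: geo_edges_ray_le => //; rewrite ltnW// ltnS leq_maxr.
exists (g (maxn m n).+1); split.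
- apply: (@mem_stem_neq (g (maxn m n).+1)); apply/ray_stemE => //.
  by exists (maxn m n).
- by apply: geo_edges_ray_le ma => //; rewrite ltnW// ltnS leq_maxl.
- by apply: geo_edges_ray_le nb => //; rewrite ltnW// ltnS leq_maxr.
Qed.

Lemma geo_to_edges (x : Tbar G) a : geo_to x a -> edges a.
Proof.
move=> h; have [v [vo /geo_edgesE[w wv ->] _]] := geo_to_vertex h h.
by apply/edgesE; exists w => //; exact: mem_stem_neq wv.
Qed.

Lemma geo_to_total (x : Tbar G) a b :
  geo_to x a -> geo_to x b -> edge_sub a b \/ edge_sub b a.
Proof.
move=> ha hb; have [v [_ /geo_edgesE[w wv ->] /geo_edgesE[z zv ->]]] := geo_to_vertex ha hb.
have wo := mem_stem_neq wv; have zo := mem_stem_neq zv.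
have [h|h] := stem_total wv zv; [right|left]; apply/edge_sub_above => //.
  by exists w.
by exists z.
Qed.

Lemma geo_to_up (x : Tbar G) a b : geo_to x a -> edge_sub a b -> geo_to x b.
Proof.
have up v : geo_edges o v a -> edge_sub a b -> geo_edges o v b.
  move=> /geo_edgesE[w wv ->] /(edge_sub_above _ (mem_stem_neq wv))[z zw ->].
  by apply/geo_edgesE; exists z => //; exact: stem_subset zw.
case: x => [[v vo]|[g rg]] /=; first exact: up.
by move=> /(geo_to_ray rg)[m ma] ab; apply/(geo_to_ray rg); exists m; exact: up ab.
Qed.

Lemma edge_sub_refl (a : {fset V}) : edges a -> edge_sub a a.
Proof.
move=> /edgesE[w wo ->]; apply/edge_sub_above => //.
by exists w => //; exact: mem_stem_self.
Qed.

Lemma edge_sub_anti (a b : {fset V}) : edges a -> edges b ->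
  edge_sub a b -> edge_sub b a -> a = b.
Proof.
move=> /edgesE[w wo ->] /edgesE[z zo ->].
move=> /(edge_sub_above _ wo)[z' z'w /(edge_above_inj zo (mem_stem_neq z'w)) ez].
move=> /(edge_sub_above _ zo)[w' w'z /(edge_above_inj wo (mem_stem_neq w'z)) ew].
by subst z' w'; rewrite (stem_anti w'z z'w).
Qed.

(** The point meant is the far end of [a]. It turns sums over the edges above [a]
    into sums along a geodesic, where telescoping applies. *)
Lemma edge_tip (a : {fset V}) : edges a -> exists x : Tbar G, geo_to x = edge_sub a.
Proof.
move=> /edgesE[w wo ->]; exists (inl (exist _ w wo)).
by rewrite /geo_to /edge_sub far_end_above.
Qed.

Lemma root_edge : exists2 a : {fset V}, edges a & forall x : Tbar G, geo_to x a.
Proof.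
have ro := @root_neq_prer G.
have rs v : v != o -> Defs.root G \in stem v.
  have [+ _ +] := stemP v; case: (stem v) => [_ /= <-|y s /=]; first by rewrite eqxx.
  by rewrite adj_prer => /andP[/eqP -> _] _ _; rewrite mem_head.
exists (edge_above (Defs.root G)); first by apply/edgesE; exists (Defs.root G).
move=> [[v vo]|[g rg]] /=.
  by apply/geo_edgesE; exists (Defs.root G) => //; exact: rs.
apply/(geo_to_ray rg); exists 1%N; apply/geo_edgesE; exists (Defs.root G) => //.
by apply/rs/(@mem_stem_neq (g 1%N)); apply/ray_stemE => //; exists 0%N.
Qed.

End TreeGeometry.

Local Open Scope ring_scope.

(** * Finite sums and extended reals *)

Lemma ler_sum_pred (R : realDomainType) (T : eqType) (s : seq T) (P Q : pred T)
    (f : T -> R) : (forall i, i \in s -> P i -> Q i) ->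
  (forall i, i \in s -> 0 <= f i) ->
  \sum_(i <- s | P i) f i <= \sum_(i <- s | Q i) f i.
Proof.
move=> PQ f0; rewrite [leLHS]big_mkcond [leRHS]big_mkcond big_seq [leRHS]big_seq.
apply: ler_sum => i si; have [/(PQ i si) -> //|_] := boolP (P i).
by case: ifP => // _; exact: f0.
Qed.

Lemma ler_sum_subseq (R : realDomainType) (T : eqType) (s t : seq T)
    (f : T -> R) : uniq s -> uniq t ->
  {subset s <= t} -> (forall a, a \in t -> 0 <= f a) ->
  \sum_(a <- s) f a <= \sum_(a <- t) f a.
Proof.
move=> us ut st f0.
have -> : \sum_(a <- s) f a = \sum_(a <- t | a \in s) f a.
  rewrite -[RHS]big_filter; apply: perm_big; apply: uniq_perm => //.
    exact: filter_uniq.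
  move=> a; rewrite mem_filter; case: (boolP (a \in s)) => //= /st ->.
  by [].
rewrite [leRHS](bigID (mem s))/= lerDl big_seq_cond sumr_ge0// => a /andP[/f0].
by [].
Qed.

Lemma eq_sum_in (T : eqType) (V : nmodType) (s : seq T) (P Q : pred T) (f : T -> V) :
  {in s, P =1 Q} -> \sum_(i <- s | P i) f i = \sum_(i <- s | Q i) f i.
Proof.
move=> PQ; rewrite big_seq_cond [RHS]big_seq_cond; apply: eq_bigl => i.
by have [/PQ ->|] := boolP (i \in s).
Qed.

Lemma ler_poweR (R : realType) (r : R) (x y : \bar R) : 0 < r -> (0 <= x)%E -> (x <= y)%E ->
  (x `^ r <= y `^ r)%E.
Proof.
move=> r0 x0 xy; apply: gt0_ler_poweR => //; first exact: ltW.
  by rewrite in_itv /= x0 leey.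
by rewrite in_itv /= leey (le_trans x0).
Qed.

(** With [0/0 = 0], [c/0 = +oo] and a finite denominator, bounding a quotient is
    the same as bounding its numerator by a product. *)
Lemma equot_le (R : realType) (a b : \bar R) (M : R) :
  (0 <= a)%E -> (0 <= b)%E -> (b < +oo)%E -> 0 <= M ->
  (equot a b <= M%:E)%E <-> (a <= M%:E * b)%E.
Proof.
case: b => [b| |]//; rewrite lee_fin => a0 b0 _ M0; rewrite /equot.
case: a a0 => [a| |]//= a0.
have [->|bn0] := eqVneq b 0.
  rewrite inve0 mule0; have [->|an0] := eqVneq a 0; first by rewrite mul0e lee_fin M0.
  have a1 : 0 < a by rewrite lt_neqAle eq_sym an0.
  rewrite gt0_muley ?lte_fin// leye_eq; split=> //.
  by rewrite lee_fin leNgt a1.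
have b1 : 0 < b by rewrite lt_neqAle eq_sym bn0.
by rewrite inver (negbTE bn0) lee_pdivrMr.
Qed.

Section FiniteSums.
Local Open Scope ereal_scope.
Variables (R : realType) (T : choiceType).

Lemma esum_seq_support (S : set T) (a : T -> \bar R) (s : seq T) : uniq s ->
  (forall i, i \in s -> 0 <= a i) ->
  \esum_(i in S) (if i \in s then a i else 0) = \sum_(i <- s | `[< S i >]) a i.
Proof.
move=> us a0; pose s' := [seq i <- s | `[< S i >]].
rewrite -big_filter -/s' fsbig_seq ?filter_uniq// -esum_fset//; last first.
  by move=> i; rewrite inE /= mem_filter => /andP[_ /a0].
rewrite (_ : [set` s'] = S `&` [set` s]); last first.
  apply/seteqP; split=> i /=; rewrite mem_filter.
    by move=> /andP[/asboolP].
  by move=> [? ->]; rewrite andbT; apply/asboolP.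
rewrite esum_mkcondr; apply: eq_esum => i _.
by have -> : (i \in [set` s]) = (i \in s) by apply/idP/idP; rewrite inE.
Qed.

Lemma le_esum_seq (S : set T) (a : T -> \bar R) (c : \bar R) :
  (forall s, uniq s -> (forall i, i \in s -> S i) -> \sum_(i <- s) a i <= c) ->
  \esum_(i in S) a i <= c.
Proof.
move=> h; apply: ge_ereal_sup => _ [X [finX XS] <-].
rewrite fsbig_finite//; apply: h; first exact: fset_uniq.
by move=> i; rewrite in_fset_set// inE => /XS.
Qed.

Lemma sum_le_esum (S : set T) (a : T -> \bar R) (s : seq T) : uniq s ->
  (forall i, i \in s -> S i) -> \sum_(i <- s) a i <= \esum_(i in S) a i.
Proof.
move=> us sS; apply: esum_ge; exists [set` s]; last by rewrite fsbig_seq.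
by split; [exact: finite_seq|move=> i /= /sS].
Qed.

End FiniteSums.

(** * Inequalities for real powers *)

Section RealInequalities.
Variables (R : realType) (p : R).
Hypothesis hp : 1 < p.

Let p0 : 0 < p. Proof. exact: lt_trans hp. Qed.
Let pn0 : p != 0. Proof. by rewrite gt_eqF. Qed.
Let p1 : 0 < p - 1. Proof. by rewrite subr_gt0. Qed.

Lemma powRV (x : R) : 0 <= x -> (x^-1) `^ p = (x `^ p)^-1.
Proof. by move=> x0; rewrite -powR_inv1// -(powR_inv1 (powR_ge0 _ _)) powRAC. Qed.

(** Young's inequality with exponents [p] and [p/(p-1)]; equivalently the graph of
    [a |-> a^p] lies above its tangent at [y]. All convexity arguments below are
    instances of it. *)
Lemma powR_tangent (a y : R) : 0 <= a -> 0 <= y ->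
  p * (a * y `^ (p - 1)) <= a `^ p + (p - 1) * y `^ p.
Proof.
move=> a0 y0; have q0 : 0 < p / (p - 1) by rewrite divr_gt0.
have /= := @conjugate_powR R a (y `^ (p - 1)) p (p / (p - 1)) a0 (powR_ge0 _ _) p0 q0.
rewrite -powRrM [(p - 1) * _]mulrC divfK ?gt_eqF// => h.
have {}h := h _; rewrite -(ler_pM2l p0) in h.
apply: le_trans (h _) _; first by rewrite invf_div; field; rewrite gt_eqF.
have p1n : p - 1 != 0 by rewrite gt_eqF.
by rewrite le_eqVlt; apply/orP; left; apply/eqP; field; rewrite pn0 p1n.
Qed.

Lemma powR_increment (u v : R) : 0 <= u -> 0 <= v ->
  v `^ p - u `^ p <= p * ((v - u) * v `^ (p - 1)).
Proof.
move=> u0 v0; have := powR_tangent u0 v0.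
by rewrite -(mulr_powRB1 v0 p0); lra.
Qed.

(** Jensen's inequality for the weights [d / D], whose sum may be less than [1];
    it follows from the tangent at the value [(sum_j w j * d j) / D]. *)
Lemma powR_jensen n (w d : nat -> R) (D : R) :
  (forall j, 0 <= w j) -> (forall j, 0 <= d j) -> \sum_(0 <= j < n) d j <= D ->
  (\sum_(0 <= j < n) w j * d j) `^ p
    <= D `^ (p - 1) * \sum_(0 <= j < n) w j `^ p * d j.
Proof.
move=> w0 d0 dD; set S := \sum_(_ <= _ < _) (_ * _).
have sd0 : 0 <= \sum_(0 <= j < n) d j by apply: sumr_ge0.
have D0 : 0 <= D by exact: le_trans dD.
have S0 : 0 <= S by apply: sumr_ge0 => j _; rewrite mulr_ge0.
have [D00|Dn0] := eqVneq D 0.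
  have S00 : S = 0.
    apply: big1_seq => j /= jn.
    have : \sum_(0 <= j < n) d j == 0 by rewrite eq_le sd0 (le_trans dD) ?D00.
    rewrite psumr_eq0// => /allP/(_ j jn)/= /eqP ->; exact: mulr0.
  rewrite S00 powR0// mulr_ge0 ?powR_ge0//.
  by apply: sumr_ge0 => j _; rewrite mulr_ge0 ?powR_ge0.
have Dp : 0 < D by rewrite lt_neqAle eq_sym Dn0.
set y := S / D; have y0 : 0 <= y by rewrite divr_ge0.
have SE : S = D * y by rewrite /y mulrC divfK.
(* the tangent at y, applied to each w j and summed with the weights d j *)
have key : p * (S * y `^ (p - 1))
    <= \sum_(0 <= j < n) w j `^ p * d j + (p - 1) * y `^ p * D.
  apply: (@le_trans _ _ (\sum_(0 <= j < n) (w j `^ p + (p - 1) * y `^ p) * d j)).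
    rewrite /S mulr_suml mulr_sumr; apply: ler_sum => j _.
    by rewrite [X in _ * X]mulrAC mulrA ler_wpM2r// powR_tangent.
  under eq_bigr do rewrite mulrDl; rewrite big_split /= lerD2l -mulr_sumr.
  by rewrite ler_wpM2l// mulr_ge0 ?powR_ge0 ?ltW.
rewrite SE -mulrA mulr_powRB1// in key.
have {}key : D * y `^ p <= \sum_(0 <= j < n) w j `^ p * d j by lra.
rewrite SE powRM// -[D `^ p](@mulr_powRB1 _ D p)// [D * _]mulrC -mulrA.
by rewrite ler_wpM2l ?powR_ge0.
Qed.

Section Levels.
Variables (eps r : R).
Hypotheses (eps0 : 0 < eps) (r1 : 1 < r).

Let r0 : 0 < r. Proof. exact: lt_trans r1. Qed.

Definition level (k : nat) : R := eps * r ^+ k.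
(** The slices [(level_pred j, level j]] start from height [0] and cover all
    heights up to any given level. *)
Definition level_pred (k : nat) : R := if k is j.+1 then level j else 0.
Definition level_gap (k : nat) : R := level k `^ p * (r `^ p - 1).
(** The weights discretize the density [s]. In the lowest slice the weight is the
    mean over the slices that the levels of negative index would cut there; this
    makes the normalization of [profile] exact. *)
Definition level_weight (j : nat) : R :=
  if j is 0 then eps * r / (1 + r) else level j.
Definition slice (j : nat) (y : R) : R :=
  Num.min y (level j) - Num.min y (level_pred j).
(** A discrete form of [min (y, t)^2 / t^2] at [t = level k]; the denominator is the
    discrete [int_0^t s ds], which tends to [t^2 / 2] as [r] tends to [1]. *)
Definition profile (k : nat) (y : R) : R :=
  (\sum_(0 <= j < k.+1) level_weight j * slice j y) / (level k ^+ 2 * r / (1 + r)).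

Lemma level_gt0 k : 0 < level k.
Proof. by rewrite mulr_gt0// exprn_gt0. Qed.

Lemma levelS k : level k.+1 = r * level k.
Proof. by rewrite /level exprS mulrCA. Qed.

Lemma level_pred_ge0 k : 0 <= level_pred k.
Proof. by case: k => //= k; exact/ltW/level_gt0. Qed.

Lemma level_pred_le k : level_pred k <= level k.
Proof.
case: k => [|k] /=; first exact/ltW/level_gt0.
by rewrite levelS ler_peMl ?ltW ?level_gt0.
Qed.

Lemma level_gap_ge0 k : 0 <= level_gap k.
Proof.
rewrite mulr_ge0 ?powR_ge0// subr_ge0.
by rewrite -[leLHS](congr1 (@^~ p) (@powR1 R)) ge0_ler_powR ?nnegrE ?ltW.
Qed.

Lemma level_gapE k : level_gap k = level k.+1 `^ p - level k `^ p.
Proof.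
rewrite /level_gap levelS powRM ?ltW ?level_gt0//; ring.
Qed.

Lemma level_weight_ge0 j : 0 <= level_weight j.
Proof.
case: j => [|j] /=; last exact/ltW/level_gt0.
by rewrite divr_ge0 ?mulr_ge0 ?addr_ge0 ?ltW.
Qed.

Lemma level_weight_le j : level_weight j <= level j.
Proof.
case: j => [|j] //=; rewrite /level expr0 mulr1.
rewrite ler_pdivrMr ?addr_gt0// ler_wpM2l ?ltW//; lra.
Qed.

Lemma slice_homo j u v : u <= v -> slice j u <= slice j v.
Proof.
move=> uv; have := level_pred_le j; rewrite /slice.
by case: (ltP u (level j)); case: (ltP v (level j)); case: (ltP u (level_pred j));
  case: (ltP v (level_pred j)); lra.
Qed.

Lemma slice0 j : slice j 0 = 0.
Proof.
by rewrite /slice !min_l ?subrr// ?level_pred_ge0// ltW// level_gt0.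
Qed.

Lemma sum_slice n y : 0 <= y ->
  \sum_(0 <= j < n) slice j y = Num.min y (level_pred n).
Proof.
move=> y0; elim: n => [|n IH]; first by rewrite big_nil /= min_r.
by rewrite big_nat_recr//= IH /slice; lra.
Qed.

Lemma profile0 k : profile k 0 = 0.
Proof. by rewrite /profile big1 ?mul0r// => j _; rewrite slice0 mulr0. Qed.

Lemma profile_norm_gt0 k : 0 < level k ^+ 2 * r / (1 + r).
Proof. by rewrite divr_gt0 ?addr_gt0// mulr_gt0// exprn_gt0// level_gt0. Qed.

Lemma profile_homo k u v : u <= v -> profile k u <= profile k v.
Proof.
move=> uv; rewrite ler_pM2r ?invr_gt0 ?profile_norm_gt0//.
by apply: ler_sum => j _; rewrite ler_wpM2l ?slice_homo ?level_weight_ge0.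
Qed.

Lemma profile1 k y : level k <= y -> profile k y = 1.
Proof.
move=> ky; rewrite /profile; set W := (X in _ / X).
suff -> : \sum_(0 <= j < k.+1) level_weight j * slice j y = W.
  by rewrite divff// gt_eqF// profile_norm_gt0.
rewrite /W {W}; elim: k ky => [|k IH] ky.
  rewrite big_nat1 /= /slice /= (min_r ky) min_r; last first.
    exact: le_trans (ltW (level_gt0 0)) ky.
  by rewrite /level expr0; field; rewrite gt_eqF ?addr_gt0.
rewrite big_nat_recr//= IH; last exact: le_trans (level_pred_le k.+1) ky.
rewrite /slice /= !min_r// ?(le_trans (level_pred_le k.+1))//.
by rewrite levelS; field; rewrite gt_eqF ?addr_gt0.
Qed.

(** Bernoulli's inequality makes the powers of [r] grow at least linearly. *)
Lemma level_unbounded (B : R) : exists n, B <= level n.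
Proof.
have bern n : 1 + n%:R * (r - 1) <= r ^+ n.
  elim: n => [|n IH]; first by rewrite mul0r addr0 expr0.
  rewrite exprS -natr1; have n0 : 0 <= n%:R :> R by [].
  have : r * (1 + n%:R * (r - 1)) <= r * r ^+ n by rewrite ler_pM2l//; lra.
  by apply: le_trans; have := mulr_ge0 n0 (sqr_ge0 (r - 1)); rewrite expr2; lra.
pose q := B / eps / (r - 1).
exists (Num.truncn q).+1; rewrite /level -ler_pdivrMl// mulrC.
apply: le_trans (bern _); have rq : 0 < r - 1 by rewrite subr_gt0.
have /ltW := truncnS_gt q; rewrite -(ler_pM2r rq) /q divfK ?gt_eqF// => h.
by apply: le_trans h _; rewrite lerDr.
Qed.

(** Summation by parts against the decreasing sequence [level^(-p)]. The boundary
    term on the left is what makes the induction close. *)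
Lemma sum_by_parts_le n (e d : nat -> R) :
  (forall j, e j <= level j `^ p * d j) -> (forall j, 0 <= e j) ->
  \sum_(0 <= k < n) ((level k `^ p)^-1 - (level k.+1 `^ p)^-1)
      * (\sum_(0 <= j < k.+1) e j)
  + (level n `^ p)^-1 * (\sum_(0 <= j < n) e j)
  <= \sum_(0 <= j < n) d j.
Proof.
move=> ed e0; elim: n => [|n IH]; first by rewrite !big_nil mulr0 addr0.
rewrite big_nat_recr//= [leRHS]big_nat_recr//=.
have : (level n `^ p)^-1 * e n <= d n.
  by rewrite mulrC ler_pdivrMr ?powR_gt0 ?level_gt0// mulrC.
have -> : \sum_(0 <= j < n.+1) e j = \sum_(0 <= j < n) e j + e n.
  by rewrite big_nat_recr.
by move=> h; move: (lerD IH h); apply: le_trans; lra.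
Qed.

(** The discrete counterpart of [int_s^oo p t^(p-1) (2 s / t^2)^p dt = 2^p].
    Jensen's inequality moves the power inside the sum over slices; then, slice by
    slice, the sum over the levels [k >= j] is a telescoping one. *)
Lemma capacitary_level_sum n u v : 0 <= u -> u <= v ->
  \sum_(0 <= k < n) level_gap k * (profile k v - profile k u) `^ p
    <= (1 + r) `^ p * (v - u) `^ p.
Proof.
move=> u0 uv; have v0 : 0 <= v by exact: le_trans uv.
pose d j := slice j v - slice j u.
have d0 j : 0 <= d j by rewrite subr_ge0 slice_homo.
have dE m : \sum_(0 <= j < m) d j <= v - u.
  rewrite sumrB !sum_slice//; have := level_pred_ge0 m.
  by case: (ltP u (level_pred m)); case: (ltP v (level_pred m)); lra.
have D0 : 0 <= v - u by rewrite subr_ge0.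
have termE k : level_gap k * (profile k v - profile k u) `^ p
    <= (1 + r) `^ p * (v - u) `^ (p - 1) *
     (((level k `^ p)^-1 - (level k.+1 `^ p)^-1)
       * (\sum_(0 <= j < k.+1) level_weight j `^ p * d j)).
  have -> : profile k v - profile k u =
      (\sum_(0 <= j < k.+1) level_weight j * d j) * (level k ^+ 2 * r / (1 + r))^-1.
    rewrite /profile -mulrBl -sumrB; congr (_ * _).
    by apply: eq_bigr => j _; rewrite -mulrBr.
  rewrite powRM ?invr_ge0; last 2 first.
  - by apply: sumr_ge0 => j _; rewrite mulr_ge0 ?level_weight_ge0.
  - exact/ltW/profile_norm_gt0.
  have := powR_jensen level_weight_ge0 d0 (dE k.+1).
  set A := (_ `^ p); set B := \sum_(_ <= _ < _) _ => AB.
  (* the gap over the normalization is a difference of consecutive level^(-p) *)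
  have cE : level_gap k * ((level k ^+ 2 * r / (1 + r))^-1) `^ p
      = (1 + r) `^ p * ((level k `^ p)^-1 - (level k.+1 `^ p)^-1).
    have l0 := level_gt0 k.
    have r1' : 0 < 1 + r by rewrite addr_gt0.
    rewrite level_gapE levelS.
    have -> : (level k ^+ 2 * r / (1 + r))^-1
      = (1 + r) * (level k)^-1 * (r * level k)^-1 by field; rewrite !gt_eqF ?addr_gt0.
    have rl0 : 0 < r * level k by rewrite mulr_gt0.
    rewrite (@powRM _ ((1 + r) / level k)) ?mulr_ge0 ?invr_ge0// ?ltW//.
    rewrite (@powRM _ (1 + r)) ?invr_ge0 ?ltW// !powRV ?ltW//.
    by field; rewrite !gt_eqF ?powR_gt0.
  set Wi := _ `^ p in cE *; set g := _ - _ in cE *.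
  have g0 : 0 <= (1 + r) `^ p * g by rewrite -cE mulr_ge0 ?level_gap_ge0 ?powR_ge0.
  have -> : level_gap k * (A * Wi) = (1 + r) `^ p * g * A by rewrite -cE; ring.
  have -> : (1 + r) `^ p * (v - u) `^ (p - 1) * (g * B)
    = (1 + r) `^ p * g * ((v - u) `^ (p - 1) * B) by ring.
  exact: ler_wpM2l.
apply: le_trans (ler_sum _ (fun k _ => termE k)) _.
rewrite -mulr_sumr -mulrA ler_wpM2l ?powR_ge0//.
rewrite -[leRHS](@mulr_powRB1 _ (v - u) p)// mulrC ler_wpM2r ?powR_ge0//.
apply: le_trans (dE n).
have e0 j : 0 <= level_weight j `^ p * d j by rewrite mulr_ge0 ?powR_ge0.
apply: le_trans (@sum_by_parts_le n _ d _ e0).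
  by rewrite lerDl mulr_ge0 ?invr_ge0 ?powR_ge0// sumr_ge0.
move=> j; rewrite ler_wpM2r// ge0_ler_powR ?nnegrE ?level_weight_ge0 ?level_weight_le//.
  exact: ltW.
exact/ltW/level_gt0.
Qed.

(** The layer-cake formula with heights rounded up to the next level: the gaps
    between [eps] and that level telescope. *)
Lemma powR_le_levels n (y : R) : 0 <= y -> y <= level n ->
  y `^ p <= eps `^ p + \sum_(0 <= k < n) level_gap k * (level k < y)%R%:R.
Proof.
move=> y0; elim: n => [|n IH] yn.
  rewrite big_nil addr0; rewrite /level expr0 mulr1 in yn.
  by rewrite ge0_ler_powR ?nnegrE// ltW.
have [/IH h|ny] := leP y (level n).
  rewrite big_nat_recr//= addrA; apply: le_trans h _.
  by rewrite lerDl mulr_ge0 ?level_gap_ge0.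
have sE m : (m <= n.+1)%N ->
    \sum_(0 <= k < m) level_gap k * (level k < y)%R%:R = level m `^ p - eps `^ p.
  elim: m => [|m IHm] mn; first by rewrite big_nil /level expr0 mulr1 subrr.
  rewrite big_nat_recr//= IHm; last exact: ltnW.
  rewrite (_ : level m < y) ?mulr1 ?level_gapE; first by ring.
  apply: le_lt_trans ny; rewrite ler_pM2l// ler_eXn2l//.
by rewrite sE// addrC subrK ge0_ler_powR ?nnegrE// ltW// level_gt0.
Qed.
End Levels.
End RealInequalities.

(** * Sums along geodesics and their integrals *)

(** In a chain, the sum strictly above an element is the sum weakly above the
    next one. *)
Lemma chain_telescope (T : eqType) (V : nmodType) (W : zmodType) (le : rel T)
    (f : V -> W) (phi : T -> V) (L : seq T) :
  pairwise le L -> uniq L ->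
  {in L, forall a, le a a} -> {in L &, forall a b, le a b -> le b a -> a = b} ->
  \sum_(a <- L) (f (\sum_(b <- L | le a b) phi b)
                 - f (\sum_(b <- L | le a b && (b != a)) phi b))
  = f (\sum_(b <- L) phi b) - f 0.
Proof.
elim: L => [|a L IH]; first by rewrite !big_nil subrr.
rewrite /= => /andP[/allP aL pL] /andP[naL uL] refl anti.
have sub c : c \in L -> c \in a :: L by move=> cL; rewrite inE cL orbT.
rewrite big_cons.
have eV : \sum_(b <- a :: L | le a b) phi b = \sum_(b <- a :: L) phi b.
  by apply: eq_sum_in => b; rewrite inE => /orP[/eqP ->|/aL ->//]; rewrite refl ?mem_head.
have eU : \sum_(b <- a :: L | le a b && (b != a)) phi b = \sum_(b <- L) phi b.
  rewrite big_cons eqxx andbF; apply: eq_sum_in => b bL.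
  by rewrite aL//=; apply: contraNneq naL => <-.
rewrite eV eU.
rewrite (_ : \sum_(c <- L) _ = f (\sum_(b <- L) phi b) - f 0); first by rewrite addrA subrK.
rewrite -IH//; last 2 first.
- by move=> c /sub; exact: refl.
- by move=> c d /sub cL /sub; exact: anti.
apply: eq_big_seq => c cL.
have nca : le c a = false.
  apply: contraNF naL => lca.
  by rewrite (anti a c)// ?mem_head ?sub// aL.
by rewrite !big_cons nca.
Qed.

Section StepSum.
Context d (T : measurableType d) (R : realType) (mu : {measure set T -> \bar R}).
Context (I : eqType) (A : I -> set T) (c : I -> R) (s : seq I).
Hypothesis mA : forall i, i \in s -> measurable (A i).

Lemma measurable_step_sum :
  measurable_fun [set: T] (fun x => \sum_(i <- s) c i * \1_(A i) x).
Proof.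
elim: s mA => [|i l IH] mAl.
  by under eq_fun do rewrite big_nil; exact: measurable_cst.
under eq_fun do rewrite big_cons; apply: measurable_funD.
  apply: measurable_funM; first exact: measurable_cst.
  by apply/measurable_indic/mAl; rewrite mem_head.
by apply: IH => j jl; apply: mAl; rewrite inE jl orbT.
Qed.

Lemma integral_step_sum : (forall i, i \in s -> 0 <= c i) ->
  (\int[mu]_x (\sum_(i <- s) c i * \1_(A i) x)%:E
     = \sum_(i <- s) (c i)%:E * mu (A i))%E.
Proof.
move=> c0; have mAi i : measurable (if i \in s then A i else set0).
  by case: ifPn => // /mA.
under eq_integral => x _ do rewrite -sumEFin big_seq.
rewrite [RHS]big_seq.
pose g i x := (`|c i| * \1_(if i \in s then A i else set0) x)%:E.
transitivity (\int[mu]_x (\sum_(i <- s) g i x))%E.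
  apply: eq_integral => x _; rewrite [RHS]big_seq; apply: eq_bigr => i si.
  by rewrite /g si ger0_norm ?c0.
rewrite ge0_integral_sum//.
- rewrite big_seq; apply: eq_bigr => i si; rewrite /g si; have mi := mA si.
  rewrite ger0_norm ?c0//; under eq_integral do rewrite EFinM.
  rewrite ge0_integralZl_EFin ?c0// ?integral_indic ?setIT//.
  by apply/measurable_EFinP/measurable_indic.
- move=> i; apply/measurable_EFinP/measurable_funM; first exact: measurable_cst.
  exact: measurable_indic.
- by move=> i x _; rewrite lee_fin mulr_ge0.
Qed.

End StepSum.

(** For these [f] the increments of [f] along a geodesic are nonnegative, and
    [f] of a path sum is a nonnegative combination of indicators of shadows. *)
Definition layerable (R : realType) (f : R -> R) :=
  f 0 = 0 /\ forall u v, 0 <= u -> u <= v -> f u <= f v.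

Lemma layerable_gt (R : realType) (t : R) : 0 <= t -> layerable (fun y : R => (t < y)%R%:R : R).
Proof.
move=> t0; split=> [|y z _ yz]; first by rewrite ltNge t0.
by rewrite ler_nat; case: (ltP t y) => // /lt_le_trans/(_ yz) ->.
Qed.

Lemma layerable_powR (R : realType) (p : R) : 1 < p -> layerable (fun y : R => y `^ p).
Proof.
move=> hp; have p0 : 0 < p by exact: lt_trans hp.
split=> [|u v u0 uv]; first by rewrite powR0// gt_eqF.
by apply: ge0_ler_powR; rewrite ?nnegrE//; [exact: ltW|exact: le_trans uv].
Qed.

Section Forest.
Variables (G : rootedTree) (R : realType).
Local Notation edge := {fset vert G}.

Definition below (a b : edge) : bool := `[< edge_sub a b >].
Definition through (x : Tbar G) (a : edge) : bool := `[< geo_to x a >].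

Definition sum_above (F : seq edge) (phi : edge -> R) (a : edge) : R :=
  \sum_(b <- F | below a b) phi b.
Definition sum_strictly_above (F : seq edge) (phi : edge -> R) (a : edge) : R :=
  \sum_(b <- F | below a b && (b != a)) phi b.
Definition path_sum (F : seq edge) (phi : edge -> R) (x : Tbar G) : R :=
  \sum_(b <- F | through x b) phi b.

Lemma below_trans (a b c : edge) : edges a -> below a b -> below b c -> below a c.
Proof.
move=> /edge_tip[x ex] /asboolP ab /asboolP bc; apply/asboolP.
by rewrite -ex; apply: geo_to_up bc; rewrite ex.
Qed.

Section FiniteFamily.
Variables (F : seq edge).
Hypotheses (uF : uniq F) (eF : forall a, a \in F -> edges a).

(** The edges of [F] through which [x] passes form a chain, and an edge of [F]
    above one of them is again one of them, so that [sum_above] can be computed in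
    the chain. *)
Lemma path_sum_telescope (W : zmodType) (f : R -> W) (phi : edge -> R) (x : Tbar G) :
  \sum_(a <- F | through x a)
     (f (sum_above F phi a) - f (sum_strictly_above F phi a))
  = f (path_sum F phi x) - f 0.
Proof.
pose L0 := [seq a <- F | through x a].
pose L := sort below L0.
have LL0 : perm_eq L L0 by rewrite perm_sort.
have memL a : a \in L -> geo_to x a /\ edges a.
  rewrite (perm_mem LL0) mem_filter => /andP[/asboolP xa _].
  by split=> //; exact: geo_to_edges xa.
have memL0 a : a \in L0 -> geo_to x a /\ edges a.
  by rewrite -(perm_mem LL0); exact: memL.
have -> : path_sum F phi x = \sum_(b <- L) phi b.
  by rewrite /path_sum -big_filter -/L0; apply/perm_big; rewrite perm_sym.
rewrite -big_filter -/L0 -(perm_big _ LL0) /=.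
rewrite -(@chain_telescope _ _ _ below).
- apply: eq_big_seq => a /memL[xa _].
  have e (P : pred edge) : \sum_(b <- F | below a b && P b) phi b
      = \sum_(b <- L | below a b && P b) phi b.
    rewrite [RHS](perm_big _ LL0) /= big_filter_cond; apply: eq_bigl => b.
    have [/asboolP ab|_] := boolP (below a b); last by rewrite andbF.
    by have -> : through x b by apply/asboolP/(geo_to_up xa ab).
  congr (f _ - f _); last exact: e.
  by have := e xpredT; under eq_bigl do rewrite andbT;
     under [in RHS]eq_bigl do rewrite andbT.
- rewrite -(@sorted_pairwise_in _ (mem L) below _ L (allss L)).
    apply: sort_sorted_in (allss L0) => a b /memL0[xa _] /memL0[xb _].
    by apply/orP; case: (geo_to_total xa xb) => h; [left|right]; apply/asboolP.
  by move=> b a c _ /memL[_ ea] _; exact: below_trans.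
- by rewrite (perm_uniq LL0) filter_uniq.
- by move=> a /memL[_ ea]; apply/asboolP/edge_sub_refl.
- move=> a b /memL[_ ea] /memL[_ eb] /asboolP ab /asboolP ba.
  exact: edge_sub_anti.
Qed.

Lemma sum_aboveE (phi : edge -> R) a : a \in F ->
  sum_above F phi a = phi a + sum_strictly_above F phi a.
Proof.
move=> aF; rewrite /sum_above /sum_strictly_above (bigID (pred1 a))/=; congr (_ + _).
rewrite (eq_bigl (pred1 a)); last first.
  move=> b /=; have [->|_] := eqVneq b a; last by rewrite andbF.
  by rewrite andbT; apply/asboolP/edge_sub_refl/eF.
by rewrite -big_filter filter_pred1_uniq// big_seq1.
Qed.

Section Nonneg.
Variable phi : edge -> R.
Hypothesis phi0 : forall a, a \in F -> 0 <= phi a.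

Lemma sum_strictly_above_ge0 a : 0 <= sum_strictly_above F phi a.
Proof. by rewrite /sum_strictly_above big_seq_cond sumr_ge0// => b /andP[/phi0]. Qed.

Lemma sum_strictly_above_le a : a \in F ->
  sum_strictly_above F phi a <= sum_above F phi a.
Proof. by move=> aF; rewrite sum_aboveE// lerDr phi0. Qed.

Lemma sum_above_ge0 a : a \in F -> 0 <= sum_above F phi a.
Proof.
by move=> /sum_strictly_above_le; apply: le_trans; exact: sum_strictly_above_ge0.
Qed.

Lemma path_sum_ge0 x : 0 <= path_sum F phi x.
Proof. by rewrite /path_sum big_seq_cond sumr_ge0// => b /andP[/phi0]. Qed.

End Nonneg.

End FiniteFamily.

Lemma measurable_shadow (a : edge) : edges a ->
  measurable (shadow a : set (borel_Tbar G)).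
Proof.
move=> ea; apply: sub_sigma_algebra.
exists [set shadow a]; last by rewrite bigcup_set1.
by move=> _ ->; apply: (@finI_from1 _ _ _ (fun A : set (Tbar G) => A)); left; exists a.
Qed.

Lemma root_shadow : exists2 w : edge, edges w &
  shadow w = [set: Tbar G].
Proof.
have [w ew hw] := root_edge G; exists w => //.
by apply/seteqP; split=> // x _; exact: hw.
Qed.

Section Integral.
Variables (mu : {measure set borel_Tbar G -> \bar R}) (F : seq edge).
Hypotheses (uF : uniq F) (eF : forall a, a \in F -> edges a).
Variable phi : edge -> R.
Hypothesis phi0 : forall a, a \in F -> 0 <= phi a.

Lemma path_sum_layers (f : R -> R) : f 0 = 0 ->
  (fun x => f (path_sum F phi x)) = (fun x => \sum_(a <- F)
     (f (sum_above F phi a) - f (sum_strictly_above F phi a)) * \1_(shadow a) x).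
Proof.
move=> f0; apply/funext => x.
have -> : f (path_sum F phi x) = f (path_sum F phi x) - f 0 by rewrite f0 subr0.
rewrite -path_sum_telescope// big_mkcond; apply: eq_bigr => a _; rewrite /through indicE.
have -> : (x \in shadow a) = `[< geo_to x a >] by apply/idP/asboolP; rewrite inE.
by case: ifP; rewrite ?mulr1 ?mulr0.
Qed.

Hypothesis mu_fin : (mu setT < +oo)%E.

Definition mass (a : edge) : R := fine (mu (shadow a)).

Lemma massE a : edges a -> mu (shadow a) = (mass a)%:E.
Proof.
move=> ea; rewrite /mass fineK// ge0_fin_numE// (le_lt_trans _ mu_fin)//.
by apply: le_measure; rewrite ?inE//; exact: measurable_shadow.
Qed.

Lemma mass_ge0 a : 0 <= mass a.
Proof. exact: fine_ge0. Qed.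

Definition layer_sum (f : R -> R) : R :=
  \sum_(a <- F) (f (sum_above F phi a) - f (sum_strictly_above F phi a)) * mass a.

Lemma measurable_path_sum (f : R -> R) : layerable f ->
  measurable_fun [set: borel_Tbar G] (fun x => (f (path_sum F phi x))%:E).
Proof.
move=> [f0 fh]; apply/measurable_EFinP; rewrite (path_sum_layers f0).
apply: measurable_step_sum => a aF; exact: (measurable_shadow (eF aF)).
Qed.

(** By telescoping, the integrand is a combination of indicators of shadows. *)
Lemma integral_path_sum (f : R -> R) : layerable f ->
  (\int[mu]_x (f (path_sum F phi x))%:E = (layer_sum f)%:E)%E.
Proof.
move=> [f0 fh].
under eq_integral => x _ do rewrite (congr1 (@^~ x) (path_sum_layers f0)).
rewrite integral_step_sum.
- rewrite /layer_sum -sumEFin; apply: eq_big_seq => a aF.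
  by rewrite EFinM massE//; exact: eF.
- by move=> a aF; exact: (measurable_shadow (eF aF)).
- move=> a aF; rewrite subr_ge0 fh// ?sum_strictly_above_ge0//.
  exact: sum_strictly_above_le.
Qed.

Lemma layerable_ge0 (f : R -> R) x : layerable f -> 0 <= f (path_sum F phi x).
Proof. by move=> [f0 fh]; rewrite -f0 fh// path_sum_ge0. Qed.

Lemma le_layer_sum (f g : R -> R) : layerable f -> layerable g ->
  (forall x, f (path_sum F phi x) <= g (path_sum F phi x)) ->
  layer_sum f <= layer_sum g.
Proof.
move=> lf lg fg; rewrite -lee_fin -!integral_path_sum//.
apply: ge0_le_integral => //=.
- by move=> x _; rewrite lee_fin layerable_ge0.
- exact: measurable_path_sum.
- exact: measurable_path_sum.
- by move=> x _; rewrite lee_fin fg.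
Qed.

Lemma layer_sum_linear (I : Type) (r : seq I) (c : I -> R) (f : I -> R -> R) :
  layer_sum (fun y => \sum_(i <- r) c i * f i y)
  = \sum_(i <- r) c i * layer_sum (f i).
Proof.
rewrite /layer_sum; under [RHS]eq_bigr do rewrite mulr_sumr.
rewrite exchange_big /=; apply: eq_bigr => a _.
rewrite -sumrB mulr_suml; apply: eq_bigr => i _.
by rewrite -mulrBr mulrA.
Qed.

Lemma layer_sumD (f g : R -> R) :
  layer_sum (fun y => f y + g y) = layer_sum f + layer_sum g.
Proof.
rewrite /layer_sum -big_split /=; apply: eq_bigr => a _; ring.
Qed.

Lemma layer_sumZ (c : R) (f : R -> R) :
  layer_sum (fun y => c * f y) = c * layer_sum f.
Proof.
rewrite /layer_sum mulr_sumr; apply: eq_bigr => a _; ring.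
Qed.

(** Path sums over edges below [a] vanish outside the shadow of [a]. *)
Lemma layer_sum_gt0_le (a : edge) : edges a ->
  (forall b, b \in F -> edge_sub b a) -> layer_sum (fun y => (0 < y)%R%:R) <= mass a.
Proof.
move=> ea Fa; have lf := @layerable_gt R 0 (lexx 0).
rewrite -lee_fin -integral_path_sum// -massE// -[shadow a]setIT.
rewrite -integral_indic//; last exact: measurable_shadow.
apply: ge0_le_integral => //=.
- exact: (measurable_path_sum lf).
- apply/measurable_EFinP; apply: measurable_indic; exact: measurable_shadow.
move=> x _; rewrite lee_fin indicE ler_nat.
have [xa|nxa] := boolP (x \in shadow a); first by case: (_ < _).
rewrite /path_sum big1_seq ?ltxx// => b /andP[/asboolP xb bF].
move: nxa; rewrite notin_setE => -[]; exact: geo_to_up (Fa _ bF).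
Qed.

End Integral.

End Forest.

(** * Reduction of the Hardy inequality to finitely many edges *)

Section Hardy.
Variables (R : realType) (G : rootedTree) (p : R).
Local Notation edge := {fset vert G}.
Variables (pi : edge -> R) (mu : {measure set borel_Tbar G -> \bar R}).
Hypotheses (hp : 1 < p) (hpi : forall a, edges a -> 0 <= pi a).

Let p0 : 0 < p. Proof. exact: lt_trans hp. Qed.
Let pn0 : p != 0. Proof. by rewrite gt_eqF. Qed.

Definition finite_energy (F : seq edge) (phi : edge -> R) : R :=
  \sum_(a <- F) phi a `^ p * pi a.

Definition hardy_admissible (C : R) : Prop := forall phi : edge -> R,
  nonneg_on_edges phi ->
  (\int[mu]_x (hardy_op phi x `^ p) <= C%:E * energy p pi phi)%E.

Lemma finite_energy_ge0 F phi :
  (forall a, a \in F -> edges a) -> 0 <= finite_energy F phi.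
Proof.
move=> eF; rewrite /finite_energy big_seq_cond sumr_ge0// => a /andP[aF _].
by rewrite mulr_ge0 ?powR_ge0// (hpi (eF _ aF)).
Qed.

Section Restriction.
Variables (F : seq edge) (phi : edge -> R).
Hypotheses (uF : uniq F) (eF : forall a, a \in F -> edges a).
Hypothesis phi0 : forall a, a \in F -> 0 <= phi a.

Definition restrict_to : edge -> R := fun a => if a \in F then phi a else 0.

Lemma restrict_to_ge0 : nonneg_on_edges restrict_to.
Proof. by move=> a _; rewrite /restrict_to; case: ifP => // /phi0. Qed.

Lemma hardy_op_restrict x : hardy_op restrict_to x = (path_sum F phi x)%:E.
Proof.
rewrite /hardy_op /restrict_to; under eq_esum do rewrite (fun_if EFin).
by rewrite esum_seq_support// -sumEFin.
Qed.

Lemma energy_restrict : energy p pi restrict_to = (finite_energy F phi)%:E.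
Proof.
rewrite /energy /restrict_to.
rewrite (@eq_esum _ _ _ _
  (fun a => if a \in F then (phi a `^ p * pi a)%:E else 0%E)); last first.
  by move=> a _; case: ifP => //; rewrite powR0// mul0r.
rewrite esum_seq_support//; last first.
  by move=> a aF; rewrite lee_fin mulr_ge0 ?powR_ge0// (hpi (eF aF)).
rewrite /finite_energy -sumEFin [RHS]big_seq [LHS]big_seq_cond.
apply: eq_bigl => a; have [aF|//] := boolP (a \in F).
by apply/asboolP; exact: eF.
Qed.

Lemma hardy_admissible_finite C : hardy_admissible C ->
  (\int[mu]_x (path_sum F phi x `^ p)%:E <= (C * finite_energy F phi)%:E)%E.
Proof.
move=> /(_ _ restrict_to_ge0); rewrite energy_restrict -EFinM; apply: le_trans.
by under [leRHS]eq_integral do rewrite hardy_op_restrict poweR_EFin.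
Qed.

End Restriction.

Definition edges_upto (n : nat) : seq edge :=
  [seq a <- pmap (@pickle_inv edge) (iota 0 n) | `[< edges a >]].

Lemma edges_upto_uniq n : uniq (edges_upto n).
Proof.
rewrite filter_uniq// (pmap_uniq (g := choice.pickle))//; last exact: iota_uniq.
exact: pickle_invK.
Qed.

Lemma edges_upto_edges n a : a \in edges_upto n -> edges a.
Proof. by rewrite mem_filter => /andP[/asboolP]. Qed.

Lemma mem_edges_upto n a : edges a -> (choice.pickle a < n)%N -> a \in edges_upto n.
Proof.
move=> /asboolP ea an; rewrite mem_filter ea /= mem_pmap.
apply/mapP; exists (choice.pickle a); first by rewrite mem_iota.
by rewrite pickleK_inv.
Qed.

Lemma edges_upto_cover (s : seq edge) : (forall a, a \in s -> edges a) ->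
  exists n, {subset s <= edges_upto n}.
Proof.
move=> es; exists (\max_(a <- s) choice.pickle a).+1 => a sa.
apply: mem_edges_upto; first exact: es.
by rewrite ltnS (@leq_bigmax_seq _ _ xpredT _ a).
Qed.

Lemma edges_upto_le m n : (m <= n)%N -> {subset edges_upto m <= edges_upto n}.
Proof.
move=> mn a; rewrite !mem_filter !mem_pmap => /andP[-> /mapP[i im ai]] /=.
apply/mapP; exists i => //; move: im; rewrite !mem_iota !add0n /= => im.
exact: leq_trans mn.
Qed.

Lemma path_sum_upto_le (phi : edge -> R) x m n : nonneg_on_edges phi -> (m <= n)%N ->
  path_sum (edges_upto m) phi x <= path_sum (edges_upto n) phi x.
Proof.
move=> phi0 mn; rewrite /path_sum -big_filter -[leRHS]big_filter; apply: ler_sum_subseq.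
- exact/filter_uniq/edges_upto_uniq.
- exact/filter_uniq/edges_upto_uniq.
- move=> a; rewrite mem_filter => /andP[xa am].
  by rewrite mem_filter xa; exact: edges_upto_le mn _ am.
- by move=> a; rewrite mem_filter => /andP[_ /edges_upto_edges]; exact: phi0.
Qed.

(** The sum along a ray may be infinite. Comparing finite subsums with the [p]-th
    root of the limit avoids any discussion of the continuity of powers at [+oo]. *)
Lemma hardy_op_powR_limn (phi : edge -> R) x : nonneg_on_edges phi ->
  (hardy_op phi x `^ p)%E =
    limn (fun n => (path_sum (edges_upto n) phi x `^ p)%:E).
Proof.
move=> phi0; pose y n := path_sum (edges_upto n) phi x.
have y0 n : 0 <= y n by apply: path_sum_ge0 => a /edges_upto_edges; exact: phi0.
have nd : nondecreasing_seq (fun n => (y n `^ p)%:E).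
  move=> m n mn; rewrite lee_fin; apply: (layerable_powR hp).2 => //; exact: path_sum_upto_le.
have cv := ereal_nondecreasing_is_cvgn nd.
have L0 n : ((y n `^ p)%:E <= limn (fun n => (y n `^ p)%:E))%E.
  by rewrite (cvg_lim _ (ereal_nondecreasing_cvgn nd))//; apply: ereal_sup_ubound; exists n.
have Lge0 := le_trans _ (L0 0%N).
have h0 : (0 <= hardy_op phi x)%E.
  by apply: esum_ge0 => a xa; rewrite lee_fin; apply/phi0/geo_to_edges/xa.
apply/eqP; rewrite eq_le; apply/andP; split; last first.
  apply: lime_le => //; apply: nearW => n; rewrite -poweR_EFin.
  apply: ler_poweR; rewrite ?lee_fin ?y0//.
  rewrite /y /path_sum -sumEFin -big_filter.
  apply: (@sum_le_esum _ _ _ (fun a => (phi a)%:E)).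
    exact/filter_uniq/edges_upto_uniq.
  by move=> a; rewrite mem_filter => /andP[/asboolP].
set L := limn _ in L0 *.
have -> : L = ((L `^ p^-1) `^ p)%E.
  by rewrite -poweRrM mulVf// poweRe1// Lge0// lee_fin powR_ge0.
apply: ler_poweR => //.
apply: le_esum_seq => s us sx.
have [|n sn] := @edges_upto_cover s; first by move=> a /sx /geo_to_edges.
apply: (@le_trans _ _ (y n)%:E).
  rewrite sumEFin lee_fin /y /path_sum -[leRHS]big_filter; apply: ler_sum_subseq => //.
  - exact/filter_uniq/edges_upto_uniq.
  - by move=> a sa; rewrite mem_filter sn// andbT; apply/asboolP/sx.
  - by move=> a; rewrite mem_filter => /andP[_ /edges_upto_edges]; exact: phi0.
have -> : (y n)%:E = ((y n `^ p)%:E `^ p^-1)%E.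
  by rewrite poweR_EFin -powRrM mulfV// powRr1.
by apply: ler_poweR; rewrite ?lee_fin ?powR_ge0 ?invr_gt0.
Qed.

(** Monotone convergence along the exhaustion [edges_upto] of the edge set. *)
Lemma hardy_admissible_limit C : 0 <= C ->
  (forall F phi, uniq F -> (forall a, a \in F -> edges a) ->
     (forall a, a \in F -> 0 <= phi a) ->
     (\int[mu]_x (path_sum F phi x `^ p)%:E <= (C * finite_energy F phi)%:E)%E) ->
  hardy_admissible C.
Proof.
move=> C0 h phi phi0.
under eq_integral do rewrite hardy_op_powR_limn//.
have phi0n n a : a \in edges_upto n -> 0 <= phi a.
  by move=> /edges_upto_edges; exact: phi0.
have mg n : measurable_fun [set: borel_Tbar G]
    (fun x => (path_sum (edges_upto n) phi x `^ p)%:E).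
  apply: measurable_path_sum (layerable_powR hp); first exact: edges_upto_uniq.
  exact: edges_upto_edges.
have nd x m n : (m <= n)%N -> ((path_sum (edges_upto m) phi x `^ p)%:E
    <= (path_sum (edges_upto n) phi x `^ p)%:E)%E.
  move=> mn; rewrite lee_fin; apply: (layerable_powR hp).2; last exact: path_sum_upto_le.
  by apply: path_sum_ge0; exact: phi0n.
rewrite monotone_convergence//.
- apply: lime_le.
    apply: ereal_nondecreasing_is_cvgn => m n mn; apply: ge0_le_integral => //.
    + by move=> x _; rewrite lee_fin powR_ge0.
    + by move=> x _; exact: nd.
  apply: nearW => n; apply: le_trans (h _ _ (edges_upto_uniq n) _ (phi0n n)) _.
    exact: edges_upto_edges.
  rewrite EFinM lee_wpmul2l ?lee_fin// /finite_energy -sumEFin.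
  apply: sum_le_esum; first exact: edges_upto_uniq.
  exact: edges_upto_edges.
- by move=> n x _; rewrite lee_fin powR_ge0.
- by move=> x _ m n mn; exact: nd.
Qed.

Lemma measurable_hardy_op_powR (phi : edge -> R) : nonneg_on_edges phi ->
  measurable_fun [set: borel_Tbar G] (fun x => hardy_op phi x `^ p)%E.
Proof.
move=> phi0; apply: (@emeasurable_fun_cvg _ (borel_Tbar G) R _
  (fun n x => (path_sum (edges_upto n) phi x `^ p)%:E)).
  move=> n; apply: measurable_path_sum (layerable_powR hp); first exact: edges_upto_uniq.
  exact: edges_upto_edges.
move=> x _; rewrite hardy_op_powR_limn//; apply: ereal_nondecreasing_is_cvgn.
move=> m n mn; rewrite lee_fin; apply: (layerable_powR hp).2; last exact: path_sum_upto_le.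
by apply: path_sum_ge0 => a /edges_upto_edges; exact: phi0.
Qed.

End Hardy.

(** * The Hardy inequality implies the isocapacitary condition *)

Section Constants.
Variables (R : realType) (G : rootedTree) (p : R).
Local Notation edge := {fset vert G}.
Variables (pi : edge -> R) (mu : {measure set borel_Tbar G -> \bar R}).
Hypotheses (hp : 1 < p) (hpi : forall a, edges a -> 0 <= pi a).

Let p0 : 0 < p. Proof. exact: lt_trans hp. Qed.
Let pn0 : p != 0. Proof. by rewrite gt_eqF. Qed.

Local Notation admissible := (hardy_admissible p pi mu).

Lemma energy_ge0 (phi : edge -> R) : (0 <= energy p pi phi)%E.
Proof. by apply: esum_ge0 => a ea; rewrite lee_fin mulr_ge0 ?powR_ge0// hpi. Qed.

Lemma capacity_ge0 (A : set (Tbar G)) : (0 <= capacity p pi A)%E.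
Proof. by apply: le_ereal_inf_tmp => _ [phi _ <-]; exact: energy_ge0. Qed.

(** The indicator of the root edge is a test function for every set. *)
Lemma capacity_lty (A : set (Tbar G)) : (capacity p pi A < +oo)%E.
Proof.
have [w ew hw] := root_edge G.
have ws a : a \in [:: w] -> edges a by rewrite inE => /eqP ->.
pose phi := restrict_to [:: w] (fun=> 1 : R).
have h : (capacity p pi A <= energy p pi phi)%E.
  apply: ereal_inf_lbound; exists phi => //; split.
    by apply: restrict_to_ge0 => *; exact: ler01.
  move=> x _; rewrite hardy_op_restrict// /path_sum big_seq_cond big_mkcond big_seq1 /=.
  by rewrite mem_head /= (_ : through x w)//; apply/asboolP.
by apply: le_lt_trans h _; rewrite energy_restrict// ?ltry.
Qed.

(** Chebyshev's inequality at height [1]. *)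
Lemma mass_le_energy (A : set (borel_Tbar G)) (phi : edge -> R) C : measurable A ->
  admissible C -> nonneg_on_edges phi ->
  (forall x, A x -> (1 <= hardy_op phi x)%E) -> (mu A <= C%:E * energy p pi phi)%E.
Proof.
move=> mA adm phi0 hA; apply: le_trans (adm _ phi0).
rewrite -[A]setIT -integral_indic//; apply: ge0_le_integral => //=.
- by apply/measurable_EFinP/measurable_indic.
- exact: measurable_hardy_op_powR.
move=> x _; rewrite indicE; have [/set_mem/hA h1|_] := boolP (x \in A); last exact: poweR_ge0.
by rewrite -(@poweR1r _ p); apply: ler_poweR.
Qed.

Lemma isocapacitary_le_admissible C : 0 <= C -> admissible C ->
  (isocapacitary_const p pi mu <= C%:E)%E.
Proof.
move=> C0 adm; apply: ge_ereal_sup => _ [n [a [ea ta ->]]].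
set U := \bigcup_(i in _) _.
have mS i : measurable (shadow (a i) : set (borel_Tbar G)) by exact: measurable_shadow.
have UE : U = \big[setU/set0]_(i < n.+1) shadow (a i).
  rewrite -(bigcup_mkord_ord (fun i => shadow (a i))); apply/seteqP.
  split=> x [i iI xi]; last by exists (inord i).
  by exists (i : nat); rewrite /= ?inord_val//; exact: ltn_ord.
have muU : mu U = (\sum_(i < n.+1) mu (shadow (a i)))%E.
  by rewrite UE measure_bigsetU_ord.
apply/equot_le => //.
- by apply: sume_ge0.
- exact: capacity_ge0.
- exact: capacity_lty.
rewrite -muU; have mU : measurable (U : set (borel_Tbar G)).
  by rewrite UE; apply: bigsetU_measurable.
have h phi : nonneg_on_edges phi -> (forall x, U x -> (1 <= hardy_op phi x)%E) ->
  (mu U <= C%:E * energy p pi phi)%E by exact: mass_le_energy.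
(* scaling an infimum of extended reals requires C > 0 *)
have [C00|Cn0] := eqVneq C 0.
  move: h; rewrite C00 => h; have := capacity_lty U.
  move=> /ereal_inf_lt[_ [phi [phi0 hphi] <-] _].
  by have := h phi phi0 hphi; rewrite !mul0e.
have Cp : 0 < C by rewrite lt_neqAle eq_sym Cn0.
rewrite -ereal_inf_pZl//; apply: le_ereal_inf_tmp => _ [_ [phi [phi0 hphi] <-] <-].
exact: h.
Qed.

(** The test function is the indicator of the root edge. *)
Lemma admissible_finite C : admissible C -> (mu setT < +oo)%E.
Proof.
move=> adm; have [w ew hw] := root_edge G.
have := @hardy_admissible_finite _ _ p pi mu hp hpi [:: w] (fun=> 1) isT _ _ C adm.
have ws a : a \in [:: w] -> edges a by rewrite inE => /eqP ->.
move=> /(_ ws (fun _ _ => ler01)).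
under eq_integral => x _.
  rewrite /path_sum big_mkcond big_seq1 (_ : through x w); last by apply/asboolP.
  rewrite powR1; over.
by rewrite integral_cst// mul1e => /le_lt_trans; apply; rewrite ltry.
Qed.

(** The family consisting of the root edge alone has an infinite quotient. *)
Lemma isocapacitary_infinite_mass : mu setT = +oo%E ->
  isocapacitary_const p pi mu = +oo%E.
Proof.
move=> muoo; have [w ew hw] := root_shadow G.
apply/eqP; rewrite -leye_eq; apply: ereal_sup_ubound.
exists 0%N, (fun=> w); split=> //.
  by move=> i j _ _ _; rewrite (ord1 i) (ord1 j).
by rewrite big_ord1 hw muoo /equot eqxx.
Qed.

End Constants.

(** * The isocapacitary condition implies the Hardy inequality *)

Section Isocapacitary.
Variables (R : realType) (G : rootedTree) (p : R).
Local Notation edge := {fset vert G}.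
Variables (pi : edge -> R) (mu : {measure set borel_Tbar G -> \bar R}).
Hypotheses (hp : 1 < p) (hpi : forall a, edges a -> 0 <= pi a).
Hypothesis mu_fin : (mu setT < +oo)%E.

Let p0 : 0 < p. Proof. exact: lt_trans hp. Qed.
Let pn0 : p != 0. Proof. by rewrite gt_eqF. Qed.

Lemma isocapacitary_seq (M : R) (s : seq edge) (phi : edge -> R) :
  0 <= M -> (isocapacitary_const p pi mu <= M%:E)%E ->
  (forall a, a \in s -> edges a) -> uniq s ->
  (forall x a b, a \in s -> b \in s -> geo_to x a -> geo_to x b -> a = b) ->
  nonneg_on_edges phi ->
  (forall x a, a \in s -> geo_to x a -> (1 <= hardy_op phi x)%E) ->
  (\sum_(a <- s) mu (shadow a) <= M%:E * energy p pi phi)%E.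
Proof.
move=> M0 hM; case: s => [|a0 s] es us ds phi0 hphi.
  by rewrite big_nil mule_ge0 ?lee_fin// energy_ge0.
pose a (i : 'I_(size s).+1) := nth a0 (a0 :: s) i.
have as_ i : a i \in a0 :: s by exact: mem_nth.
have -> : (\sum_(b <- a0 :: s) mu (shadow b) = \sum_(i < (size s).+1) mu (shadow (a i)))%E.
  by rewrite (big_nth a0) big_mkord.
have h : (equot (\sum_(i < (size s).+1) mu (shadow (a i)))
    (capacity p pi (\bigcup_(i in [set: 'I_(size s).+1]) shadow (a i))) <= M%:E)%E.
  apply: le_trans hM; apply: ereal_sup_ubound; exists (size s), a; split=> //.
    by move=> i; exact: es.
  move=> i j _ _ [x [xi xj]]; apply/ord_inj/eqP.
  rewrite -(@nth_uniq _ a0 (a0 :: s) i j (ltn_ord i) (ltn_ord j) us); apply/eqP.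
  exact: ds xi xj.
have sum0 : (0 <= \sum_(i < (size s).+1) mu (shadow (a i)))%E by apply: sume_ge0.
move/equot_le : h => /(_ sum0 (capacity_ge0 p hpi _) (capacity_lty hp hpi _) M0).
move=> /le_trans; apply; rewrite lee_wpmul2l ?lee_fin//.
apply: ereal_inf_lbound; exists phi => //; split=> // x [i _ xi].
exact: hphi xi.
Qed.

Section Family.
Variables (F : seq edge) (phi : edge -> R).
Hypotheses (uF : uniq F) (eF : forall a, a \in F -> edges a).
Hypothesis phi0 : forall a, a \in F -> 0 <= phi a.

Local Notation u := (sum_strictly_above F phi).
Local Notation v := (sum_above F phi).

(** The sum of [phi] first exceeds [t] at these edges, so their shadows make up
    the set where the path sum exceeds [t]. *)
Definition crossing (t : R) : seq edge := [seq a <- F | (u a <= t) && (t < v a)].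

Lemma layer_sum_crossing t :
  layer_sum mu F phi (fun y => (t < y)%R%:R) = \sum_(a <- crossing t) mass mu a.
Proof.
rewrite big_filter big_mkcond /layer_sum; apply: eq_big_seq => a aF.
have := sum_strictly_above_le uF eF phi0 aF.
by case: (ltP t (u a)); case: (ltP t (v a)); rewrite /= ?subr0 ?subrr ?mul0r ?mul1r//; lra.
Qed.

(** Strictly below an edge where [t] has been exceeded, even the sum strictly
    above the edge exceeds [t]. *)
Lemma crossing_disjoint t x a b : a \in crossing t -> b \in crossing t ->
  geo_to x a -> geo_to x b -> a = b.
Proof.
have key c d : c \in crossing t -> d \in crossing t -> edge_sub c d -> c = d.
  rewrite !mem_filter => /andP[/andP[uc _] cF] /andP[/andP[_ vd] dF] cd.
  apply/eqP/negPn/negP => ncd.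
  (* an edge c strictly below d would have t < v d <= u c <= t *)
  suff : v d <= u c by lra.
  apply: ler_sum_pred => // e eF' /asboolP de.
  have ce : below c e.
    by apply: (@below_trans _ c d e (eF cF)); apply/asboolP.
  rewrite ce /=; apply: contraNneq ncd => ec; apply/eqP.
  by apply: (edge_sub_anti (eF cF) (eF dF) cd); rewrite -ec.
move=> ca cb xa xb; have [ab|ba] := geo_to_total xa xb; first exact: key.
by apply/esym/key.
Qed.

(** The increments of [L] telescope to [L (path_sum F phi x)], which is at least [1]
    where the path sum exceeds [t]: they form a test function for the capacity of
    that set. *)
Lemma isocapacitary_crossing (M t : R) (L : R -> R) :
  0 <= M -> (isocapacitary_const p pi mu <= M%:E)%E ->
  layerable L -> (forall y, t < y -> 1 <= L y) ->
  layer_sum mu F phi (fun y => (t < y)%R%:R)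
    <= M * finite_energy p pi F (fun a => L (v a) - L (u a)).
Proof.
move=> M0 hM [L0 Lh] Lt; rewrite layer_sum_crossing.
pose psi a := L (v a) - L (u a).
have psi0 a : a \in F -> 0 <= psi a.
  move=> aF; rewrite subr_ge0 Lh//; first exact: sum_strictly_above_ge0.
  exact: sum_strictly_above_le.
have cF a : a \in crossing t -> a \in F by rewrite mem_filter => /andP[].
rewrite -lee_fin EFinM -energy_restrict// -sumEFin.
have -> : (\sum_(a <- crossing t) (mass mu a)%:E = \sum_(a <- crossing t) mu (shadow a))%E.
  by apply: eq_big_seq => a /cF /eF ea; rewrite massE.
apply: isocapacitary_seq => //.
- by move=> a /cF; exact: eF.
- exact: filter_uniq.
- by move=> x a b; exact: crossing_disjoint.
- exact: restrict_to_ge0.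
move=> x a ac xa; rewrite hardy_op_restrict// lee_fin.
have := path_sum_telescope uF L phi x.
rewrite L0 subr0 => h; rewrite /path_sum h; apply: Lt.
move: ac; rewrite mem_filter => /andP[/andP[_ tv] aF].
apply: lt_le_trans tv _; apply: ler_sum_pred => // b bF /asboolP ab.
by apply/asboolP; exact: geo_to_up ab.
Qed.

(** Layer cake over the levels; at each level the isocapacitary condition is tested
    on the increments of [profile], and exchanging the sums leaves
    [capacitary_level_sum] edge by edge. *)
Lemma isocapacitary_layer_sum (M eps r : R) :
  0 <= M -> (isocapacitary_const p pi mu <= M%:E)%E -> 0 < eps -> 1 < r ->
  layer_sum mu F phi (fun y => y `^ p)
    <= eps `^ p * fine (mu setT) + (1 + r) `^ p * M * finite_energy p pi F phi.
Proof.
move=> M0 hM e0 r1.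
have [n hn] := level_unbounded e0 r1 (\sum_(a <- F) phi a).
(* g is the layer-cake majorant of y^p; its first term accounts for heights below eps *)
pose g y := eps `^ p * (0 < y)%R%:R
  + \sum_(0 <= k < n) level_gap p eps r k * (level eps r k < y)%R%:R.
have lg : layerable g.
  rewrite /g; split=> [|y z y0 yz].
    rewrite ltxx mulr0 add0r big1// => k _.
    by rewrite ltNge ltW ?mulr0// level_gt0.
  apply: lerD; first by rewrite ler_wpM2l ?powR_ge0//; apply: (layerable_gt (lexx 0)).2.
  apply: ler_sum => k _; rewrite ler_wpM2l ?level_gap_ge0//.
  by apply: (layerable_gt (ltW (level_gt0 e0 r1 k))).2.
have le_g x : path_sum F phi x `^ p <= g (path_sum F phi x).
  set y := path_sum F phi x; have y0 : 0 <= y by exact: path_sum_ge0.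
  have [->|yn0] := eqVneq y 0; first by rewrite powR0// lg.1.
  have yp : 0 < y by rewrite lt_neqAle eq_sym yn0.
  rewrite /g yp mulr1; apply: powR_le_levels => //.
  by apply: le_trans hn; apply: ler_sum_pred.
apply: le_trans (@le_layer_sum _ _ _ _ uF eF _ phi0 mu_fin _ _ (layerable_powR hp) lg le_g) _.
rewrite /g layer_sumD layer_sumZ layer_sum_linear; apply: lerD.
  have [w ew hw] := root_edge G; have [w' ew' hw'] := root_shadow G.
  rewrite ler_wpM2l ?powR_ge0// -[X in _ <= fine (mu X)]hw'.
  apply: layer_sum_gt0_le => // b bF.
  have [x ex] := edge_tip (eF bF).
  have : shadow w' x by rewrite hw'.
  by rewrite /shadow /= ex.
pose ps k a := profile eps r k (v a) - profile eps r k (u a).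
have step k : level_gap p eps r k * layer_sum mu F phi (fun y => (level eps r k < y)%R%:R)
    <= M * (\sum_(a <- F) level_gap p eps r k * ps k a `^ p * pi a).
  under eq_bigr do rewrite -mulrA.
  rewrite -mulr_sumr mulrCA ler_wpM2l ?level_gap_ge0//.
  apply: isocapacitary_crossing => //.
    split; first exact: profile0.
    by move=> y z _; exact: profile_homo.
  by move=> y ky; rewrite profile1// ltW.
apply: le_trans (ler_sum _ (fun k _ => step k)) _.
rewrite -mulr_sumr exchange_big /= [_ * M]mulrC -mulrA ler_wpM2l//.
rewrite /finite_energy mulr_sumr big_seq [leRHS]big_seq; apply: ler_sum => a aF.
rewrite -mulr_suml mulrA ler_wpM2r ?(hpi (eF aF))//.
apply: le_trans (capacitary_level_sum hp e0 r1 n _ _) _.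
- exact: sum_strictly_above_ge0.
- exact: sum_strictly_above_le.
by rewrite [v a]sum_aboveE// addrK.
Qed.

End Family.

End Isocapacitary.

Section Bounds.
Variables (R : realType) (G : rootedTree) (p : R).
Local Notation edge := {fset vert G}.
Variables (pi : edge -> R) (mu : {measure set borel_Tbar G -> \bar R}).
Hypotheses (hp : 1 < p) (hpi : forall a, edges a -> 0 <= pi a).

Let p0 : 0 < p. Proof. exact: lt_trans hp. Qed.
Let pn0 : p != 0. Proof. by rewrite gt_eqF. Qed.
Let p1 : 0 < p - 1. Proof. by rewrite subr_gt0. Qed.
Let p1n : p - 1 != 0. Proof. by rewrite gt_eqF. Qed.

Local Notation admissible := (hardy_admissible p pi mu).
Local Notation q := (pconj p).

Lemma hardy_const_le C : 0 <= C -> admissible C -> (hardy_const p pi mu <= C%:E)%E.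
Proof. by move=> C0 adm; apply: ereal_inf_lbound; exists C. Qed.

Lemma finite_total (x : \bar R) : (mu setT = +oo -> x = +oo)%E ->
  (x < +oo)%E -> (mu setT < +oo)%E.
Proof.
move=> h xoo; rewrite ltey; apply/eqP => /h xE.
by move: xoo; rewrite xE.
Qed.

Lemma admissible_of_layer_sum C : 0 <= C -> (mu setT < +oo)%E ->
  (forall F phi, uniq F -> (forall a, a \in F -> edges a) ->
     (forall a, a \in F -> 0 <= phi a) ->
     layer_sum mu F phi (fun y => y `^ p) <= C * finite_energy p pi F phi) ->
  admissible C.
Proof.
move=> C0 mu_fin h; apply: hardy_admissible_limit => // F phi uF eF phi0.
rewrite (integral_path_sum uF eF phi0 mu_fin (layerable_powR hp)) lee_fin.
exact: h.
Qed.

Lemma isocapacitary_admissible (M r : R) : 0 <= M ->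
  (isocapacitary_const p pi mu <= M%:E)%E -> 1 < r -> admissible ((1 + r) `^ p * M).
Proof.
move=> M0 hM r1.
have mu_fin : (mu setT < +oo)%E.
  apply: (finite_total (isocapacitary_infinite_mass p pi (mu := mu))).
  exact: le_lt_trans hM (ltry _).
apply: admissible_of_layer_sum => //; first by rewrite mulr_ge0 ?powR_ge0.
move=> F phi uF eF phi0; apply/ler_addgt0Pr => e e0.
set m := fine (mu setT); have m0 : 0 <= m by exact: fine_ge0.
have m1 : 0 < m + 1 by lra.
(* eps is chosen below with eps^p = e / (m + 1), so that the error is at most e *)
have em0 : 0 < e / (m + 1) by rewrite divr_gt0.
have := isocapacitary_layer_sum hp hpi mu_fin uF eF phi0 M0 hM
  (powR_gt0 p^-1 em0) r1.
rewrite -powRrM mulVf// powRr1 ?(ltW em0)// => /le_trans; apply.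
by rewrite addrC lerD2l mulrAC ler_pdivrMr// ler_pM2l// lerDl.
Qed.

Lemma hardy_le_isocapacitary (M : R) : 0 <= M ->
  (isocapacitary_const p pi mu <= M%:E)%E ->
  (hardy_const p pi mu <= (2 `^ p * M)%:E)%E.
Proof.
move=> M0 hM; apply/lee_addgt0Pr => e e0.
have M1 : 0 < M + 1 by lra.
(* r > 1 is chosen with (1 + r)^p = Q, so that the excess over 2^p * M is at most e *)
pose Q := 2 `^ p + e / (M + 1).
have em0 : 0 < e / (M + 1) by rewrite divr_gt0.
have Q0 : 0 < Q by rewrite addr_gt0 ?powR_gt0.
pose r := Q `^ p^-1 - 1.
have r1 : 1 < r.
  rewrite ltrBrDr (_ : 1 + 1 = 2)//.
  have -> : 2 = (2 `^ p) `^ p^-1 :> R by rewrite -powRrM mulfV// powRr1.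
  apply: gt0_ltr_powR; rewrite ?invr_gt0 ?nnegrE ?powR_ge0 ?ltW//.
  by rewrite /Q ltrDl.
have rE : (1 + r) `^ p = Q.
  by rewrite /r addrC subrK -powRrM mulVf// powRr1// ltW.
apply: le_trans (hardy_const_le _ (isocapacitary_admissible M0 hM r1)) _.
  by rewrite mulr_ge0 ?powR_ge0.
by rewrite rE -EFinD lee_fin /Q mulrDl lerD2l mulrAC ler_pdivrMr// ler_pM2l// lerDl.
Qed.

(** * The mass-energy condition *)

(** The summand of the mass-energy condition as a real number. Where [pi] vanishes
    the value [0] is the right one only if the mass of the shadow vanishes too,
    which each of the conditions forces. *)
Definition dual_mass (a : edge) : R :=
  if pi a == 0 then 0 else pi a `^ (1 - q) * mass mu a `^ q.

Lemma dual_mass_ge0 a : 0 <= dual_mass a.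
Proof. by rewrite /dual_mass; case: ifP => // _; rewrite mulr_ge0 ?powR_ge0. Qed.

Lemma pconj_gt1 : 1 < q.
Proof. by rewrite /pconj ltr_pdivlMr// mul1r; lra. Qed.

Let q0 : 0 < q. Proof. exact: lt_trans pconj_gt1. Qed.
Let qn0 : q != 0. Proof. by rewrite gt_eqF. Qed.

Lemma pconjB1 : (q - 1) * (p - 1) = 1.
Proof. by rewrite /pconj; field. Qed.

Lemma pconjB1p : (q - 1) * p = q.
Proof. by rewrite /pconj; field. Qed.

Lemma pconjB1V : (q - 1)^-1 = p - 1.
Proof.
have h : q - 1 != 0 by rewrite gt_eqF// subr_gt0 pconj_gt1.
by apply: (mulfI h); rewrite pconjB1 divff.
Qed.

Lemma dual_massE a : (mu setT < +oo)%E -> edges a -> (pi a = 0 -> mass mu a = 0) ->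
  (dual_weight p (pi a) * mu (shadow a) `^ q)%E = (dual_mass a)%:E.
Proof.
move=> mu_fin ea h; rewrite (massE mu_fin ea) /dual_weight /dual_mass.
by case: eqVneq => [/h ->|//]; rewrite poweR_EFin powR0// mule0.
Qed.

(** This is [powR_tangent] at [y = w * (m / t)^(q-1) / l], multiplied by
    [l^(p-1) * t]. *)
Lemma young_dual (a w t m l : R) : 0 <= a -> 0 <= w -> 0 < t -> 0 <= m -> 0 < l ->
  p * (a * w `^ (p - 1) * m)
    <= l `^ (p - 1) * (a `^ p * t) + (p - 1) * l^-1 * (w `^ p * (t `^ (1 - q) * m `^ q)).
Proof.
move=> a0 w0 t0 m0 l0.
have tge0 := ltW t0; have lge0 := ltW l0.
have mt0 : 0 <= m / t by rewrite divr_ge0.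
pose y := w * (m / t) `^ (q - 1) / l.
have y0 : 0 <= y by rewrite /y divr_ge0// mulr_ge0// powR_ge0.
have := powR_tangent hp a0 y0.
have lp0 : 0 < l `^ (p - 1) by rewrite powR_gt0.
rewrite -(ler_pM2l (mulr_gt0 lp0 t0)) mulrDr.
have wm0 : 0 <= w * (m / t) `^ (q - 1) by rewrite mulr_ge0 ?powR_ge0.
have li0 : 0 <= l^-1 by rewrite invr_ge0 ltW.
have yE : y `^ (p - 1) = w `^ (p - 1) * (m / t) * (l `^ (p - 1))^-1.
  rewrite /y powRM// powRM ?powR_ge0// -powRrM pconjB1 powRr1//.
  by rewrite powRV.
have yE' : y `^ p = w `^ p * (m `^ q * (t `^ q)^-1) * (l `^ p)^-1.
  rewrite /y powRM// powRM ?powR_ge0// -powRrM pconjB1p powRM ?invr_ge0//.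
  by rewrite !powRV.
have tE : t `^ (1 - q) = t / t `^ q.
  by rewrite powRB ?powRr1// (gt_eqF t0) implybT.
have lE : l `^ p = l * l `^ (p - 1) by rewrite mulr_powRB1// ltW.
rewrite yE yE' tE lE; have tq0 : 0 < t `^ q by rewrite powR_gt0.
move=> h; apply: le_trans (le_trans h _).
  rewrite le_eqVlt; apply/orP; left; apply/eqP; field.
  by rewrite !gt_eqF.
rewrite le_eqVlt; apply/orP; left; apply/eqP; field.
by rewrite !gt_eqF.
Qed.

(** The power [v a ^ p] is the sum of its increments over the edges above [a].
    After exchanging the sums, the increment at [c] is multiplied by the total
    weight [s] below [c]. *)
Lemma carleson (K : R) (F : seq edge) (phi s : edge -> R) : uniq F ->
  (forall a, a \in F -> edges a) -> (forall a, a \in F -> 0 <= phi a) ->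
  (forall c, c \in F -> \sum_(a <- F | below a c) s a <= K * mass mu c) ->
  \sum_(a <- F) sum_above F phi a `^ p * s a
    <= K * layer_sum mu F phi (fun y => y `^ p).
Proof.
move=> uF eF phi0 hK.
pose D c := sum_above F phi c `^ p - sum_strictly_above F phi c `^ p.
have D0 c : c \in F -> 0 <= D c.
  move=> cF; rewrite subr_ge0; apply: (layerable_powR hp).2.
    exact: sum_strictly_above_ge0.
  exact: sum_strictly_above_le.
have vE a : a \in F -> sum_above F phi a `^ p = \sum_(c <- F | below a c) D c.
  move=> aF; have [x ex] := edge_tip (eF _ aF).
  have thr c : through x c = below a c by rewrite /through ex.
  have := path_sum_telescope uF (fun y => y `^ p) phi x.
  rewrite powR0// subr0 (eq_bigl _ _ thr) => ->; congr (_ `^ _).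
  by rewrite /path_sum (eq_bigl _ _ thr).
have -> : \sum_(a <- F) sum_above F phi a `^ p * s a
    = \sum_(a <- F) \sum_(c <- F) (if below a c then D c * s a else 0).
  apply: eq_big_seq => a aF; rewrite vE// mulr_suml big_mkcond.
  by apply: eq_bigr => c _; case: ifP => //; rewrite mul0r.
rewrite exchange_big /= /layer_sum mulr_sumr big_seq [leRHS]big_seq.
apply: ler_sum => c cF; rewrite -big_mkcond -mulr_sumr mulrCA ler_wpM2l ?D0//.
exact: hK.
Qed.

(** With [l = p K], [young_dual] and [carleson] give [X <= (p K)^(p-1) E + (1 - 1/p) X];
    since [X] is finite, it can be absorbed on the left. *)
Lemma layer_sum_le_dual_mass (K : R) (F : seq edge) (phi : edge -> R) : 0 <= K ->
  uniq F -> (forall a, a \in F -> edges a) -> (forall a, a \in F -> 0 <= phi a) ->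
  (forall a, a \in F -> pi a = 0 -> mass mu a = 0) ->
  (forall c, c \in F -> \sum_(a <- F | below a c) dual_mass a <= K * mass mu c) ->
  layer_sum mu F phi (fun y => y `^ p)
    <= p `^ p * K `^ (p - 1) * finite_energy p pi F phi.
Proof.
move=> K0 uF eF phi0 hpi0 hK.
have E0 : 0 <= finite_energy p pi F phi by exact: finite_energy_ge0.
have [K00|Kn0] := eqVneq K 0.
  (* for K = 0 the parameter l would vanish, but then all masses do *)
  have m0 a : a \in F -> mass mu a = 0.
    move=> aF; have [/hpi0 -> //|pin0] := eqVneq (pi a) 0.
    have : dual_mass a <= 0.
      have := hK _ aF; rewrite K00 mul0r; apply: le_trans.
      have aa : below a a by apply/asboolP/edge_sub_refl/(eF _ aF).
      rewrite big_mkcond (bigD1_seq a)//= aa lerDl sumr_ge0// => b _.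
      by case: ifP => // _; exact: dual_mass_ge0.
    rewrite /dual_mass (negbTE pin0) => h.
    have : pi a `^ (1 - q) * mass mu a `^ q == 0.
      by rewrite eq_le h mulr_ge0 ?powR_ge0.
    rewrite mulf_eq0 => /orP[]; rewrite powR_eq0.
      by rewrite (negbTE pin0).
    by move=> /andP[/eqP].
  rewrite /layer_sum big1_seq; last by move=> a /andP[_ /m0 ->]; rewrite mulr0.
  by rewrite mulr_ge0// mulr_ge0 ?powR_ge0.
have Kp : 0 < K by rewrite lt_neqAle eq_sym Kn0.
set X := layer_sum _ _ _ _; pose l := p * K.
have l0 : 0 < l by rewrite mulr_gt0.
have hX : X <= l `^ (p - 1) * finite_energy p pi F phi
    + (p - 1) * l^-1 * (\sum_(a <- F) sum_above F phi a `^ p * dual_mass a).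
  rewrite /X /layer_sum /finite_energy !mulr_sumr -big_split /= big_seq [leRHS]big_seq.
  apply: ler_sum => a aF.
  have v0 := sum_above_ge0 uF eF phi0 aF.
  have u0 := sum_strictly_above_ge0 phi0 a.
  have m0 := mass_ge0 mu a.
  apply: le_trans (ler_wpM2r m0 (powR_increment hp u0 v0)) _.
  rewrite [X in X - _](sum_aboveE uF eF _ aF) addrK -[leLHS]mulrA.
  have [pi0|pin0] := eqVneq (pi a) 0.
    rewrite hpi0// !mulr0 addr_ge0// ?mulr_ge0 ?powR_ge0 ?dual_mass_ge0//.
    all: rewrite ?invr_ge0 ?(ltW p1) ?(ltW l0)//.
    by rewrite pi0.
  have pi_gt0 : 0 < pi a by rewrite lt_neqAle eq_sym pin0 (hpi (eF _ aF)).
  rewrite /dual_mass (negbTE pin0). apply: young_dual => //; exact: phi0.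
have hC := carleson uF eF phi0 hK; rewrite -/X in hC.
have : (p - 1) * l^-1 * (\sum_(a <- F) sum_above F phi a `^ p * dual_mass a)
    <= (p - 1) * l^-1 * (K * X).
  by apply: ler_wpM2l => //; rewrite mulr_ge0 ?invr_ge0 ?ltW.
have -> : (p - 1) * l^-1 * (K * X) = X - p^-1 * X.
  by rewrite /l; field; rewrite Kn0 pn0.
move=> h; have {}h : p^-1 * X <= l `^ (p - 1) * finite_energy p pi F phi by lra.
move: h; rewrite ler_pdivrMl// => /le_trans; apply.
rewrite /l powRM ?(ltW p0)// -[p `^ p](mulr_powRB1 (ltW p0) p0) !mulrA.
exact: lexx.
Qed.

Lemma mass_energy_sum_ge0 (a : edge) : (0 <= \esum_(b in [set b | edges b /\ edge_sub b a])
   (dual_weight p (pi b) * mu (shadow b) `^ q))%E.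
Proof.
apply: esum_ge0 => b _; rewrite mule_ge0 ?poweR_ge0// /dual_weight.
by case: ifP => // _; rewrite lee_fin powR_ge0.
Qed.

(** At the root edge the summand of that edge is already infinite. *)
Lemma mass_energy_infinite_mass : mu setT = +oo%E -> mass_energy_sup p pi mu = +oo%E.
Proof.
move=> muoo; have [w ew hw] := root_shadow G.
apply/eqP; rewrite -leye_eq; apply: ereal_sup_ubound; exists w => //.
suff -> : (\esum_(b in [set b | edges b /\ edge_sub b w])
    (dual_weight p (pi b) * mu (shadow b) `^ q) = +oo)%E by rewrite /equot eqxx.
apply/eqP; rewrite -leye_eq.
have ww : edges w /\ edge_sub w w by split=> //; exact: edge_sub_refl.
have := @sum_le_esum _ _ [set b | edges b /\ edge_sub b w]
  (fun b => dual_weight p (pi b) * mu (shadow b) `^ q)%E [:: w] isT.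
rewrite big_seq1 hw muoo poweRyr// gt0_muley => [|].
  by apply => b; rewrite inE => /eqP ->.
rewrite /dual_weight; case: eqVneq => // pin0; rewrite lte_fin powR_gt0//.
by rewrite lt_neqAle eq_sym pin0 hpi.
Qed.

Lemma mass_energy_admissible (K : R) : 0 <= K -> (mass_energy_sup p pi mu <= K%:E)%E ->
  admissible (p `^ p * K `^ (p - 1)).
Proof.
move=> K0 hK.
have mu_fin : (mu setT < +oo)%E.
  apply: (finite_total mass_energy_infinite_mass).
  exact: le_lt_trans hK (ltry _).
have key c : edges c -> (\esum_(b in [set b | edges b /\ edge_sub b c])
    (dual_weight p (pi b) * mu (shadow b) `^ q) <= (K * mass mu c)%:E)%E.
  move=> ec; rewrite EFinM -massE//; apply/equot_le => //.
  - exact: mass_energy_sum_ge0.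
  - by rewrite massE// ltry.
  - by apply: le_trans hK; apply: ereal_sup_ubound; exists c.
have pi0 a : edges a -> pi a = 0 -> mass mu a = 0.
  move=> ea pia; apply/eqP/negPn/negP => mn0.
  have := key _ ea; rewrite leNgt => /negP; apply.
  apply: (@lt_le_trans _ _ +oo%E); first exact: ltry.
  have aa : edges a /\ edge_sub a a by split=> //; exact: edge_sub_refl.
  have := @sum_le_esum _ _ [set b | edges b /\ edge_sub b a]
    (fun b => dual_weight p (pi b) * mu (shadow b) `^ q)%E [:: a] isT.
  rewrite big_seq1 massE// poweR_EFin /dual_weight pia eqxx gt0_mulye.
    by apply => b; rewrite inE => /eqP ->.
  by rewrite lte_fin powR_gt0// lt_neqAle eq_sym mn0 mass_ge0.
apply: admissible_of_layer_sum => //; first by rewrite mulr_ge0 ?powR_ge0.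
move=> F phi uF eF phi0; apply: layer_sum_le_dual_mass => //.
  by move=> a aF; apply: pi0; exact: eF.
move=> c cF; rewrite -lee_fin; apply: le_trans (key c (eF _ cF)).
rewrite -big_filter -sumEFin.
have -> : (\sum_(a <- [seq a <- F | below a c]) (dual_mass a)%:E =
    \sum_(a <- [seq a <- F | below a c]) dual_weight p (pi a) * mu (shadow a) `^ q)%E.
  apply: eq_big_seq => a; rewrite mem_filter => /andP[_ /eF ea].
  by rewrite dual_massE//; exact: pi0.
apply: sum_le_esum; first exact: filter_uniq.
by move=> a; rewrite mem_filter => /andP[/asboolP ac /eF ea].
Qed.

Lemma admissible_layer_sum C F phi : (mu setT < +oo)%E -> admissible C ->
  uniq F -> (forall a, a \in F -> edges a) -> (forall a, a \in F -> 0 <= phi a) ->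
  layer_sum mu F phi (fun y => y `^ p) <= C * finite_energy p pi F phi.
Proof.
move=> mu_fin adm uF eF phi0.
rewrite -lee_fin -(integral_path_sum uF eF phi0 mu_fin (layerable_powR hp)).
exact: hardy_admissible_finite.
Qed.

(** The test function is the indicator of [a]. *)
Lemma admissible_mass C (a : edge) : (mu setT < +oo)%E -> admissible C -> edges a ->
  mass mu a <= C * pi a.
Proof.
move=> mu_fin adm ea.
have ws b : b \in [:: a] -> edges b by rewrite inE => /eqP ->.
have := admissible_layer_sum mu_fin adm (F := [:: a]) (phi := fun=> 1) isT ws (fun _ _ => ler01).
rewrite /layer_sum /finite_energy !big_seq1 powR1 mul1r sum_aboveE ?mem_head//.
rewrite /sum_strictly_above big_mkcond big_seq1 eqxx andbF addr0 powR1 powR0// subr0.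
by rewrite mul1r.
Qed.

(** For [phi = (mu(S) / pi)^(q-1)] carried by finitely many edges below [c], both the
    energy of [phi] and the integral of [I phi] equal the sum [A] that has to be
    bounded. Integrating [p s^(p-1) y <= y^p + (p-1) s^p] over the shadow of [c],
    with [y = I phi], and using [int (I phi)^p <= C A], the choice
    [s = A / mu(S c)] leaves [s^(p-1) <= C]. *)
Lemma mass_energy_le (C : R) : 0 <= C -> admissible C ->
  (mass_energy_sup p pi mu <= (C `^ (p - 1)^-1)%:E)%E.
Proof.
move=> C0 adm; have mu_fin := admissible_finite hp hpi adm.
apply: ge_ereal_sup => _ [c ec <-]; apply/equot_le => //.
- exact: mass_energy_sum_ge0.
- by rewrite massE// ltry.
- exact: powR_ge0.
rewrite massE// -EFinM; apply: le_esum_seq => F uF Fc.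
have eF a : a \in F -> edges a by move=> /Fc[].
have pi0 a : edges a -> pi a = 0 -> mass mu a = 0.
  move=> ea pia; apply/eqP; rewrite eq_le mass_ge0 andbT.
  by have := admissible_mass mu_fin adm ea; rewrite pia mulr0.
have -> : (\sum_(a <- F) dual_weight p (pi a) * mu (shadow a) `^ q
    = (\sum_(a <- F) dual_mass a)%:E)%E.
  by rewrite -sumEFin; apply: eq_big_seq => a /eF ea; rewrite dual_massE//; exact: pi0.
rewrite lee_fin; set A := \sum_(a <- F) _.
pose phi a := if pi a == 0 then 0 else (mass mu a / pi a) `^ (q - 1).
have phi0 a : a \in F -> 0 <= phi a by rewrite /phi; case: ifP => // _ _; exact: powR_ge0.
have eE : finite_energy p pi F phi = A.
  apply: eq_big_seq => a /eF ea; rewrite /phi /dual_mass; case: eqVneq => pin0.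
    by rewrite powR0// mul0r.
  rewrite -powRrM pconjB1p powRM ?mass_ge0 ?invr_ge0 ?hpi// powRV ?hpi//.
  rewrite powRB ?powRr1 ?hpi//; last by rewrite pin0 implybT.
  by ring.
have mE : layer_sum mu F phi id = A.
  apply: eq_big_seq => a aF; have ea := eF _ aF.
  rewrite sum_aboveE// addrK /phi /dual_mass; case: eqVneq => pin0; first by rewrite mul0r.
  have pi_gt0 : 0 < pi a by rewrite lt_neqAle eq_sym pin0 hpi.
  have [m0|mn0] := eqVneq (mass mu a) 0; first by rewrite m0 !(powR0, mulr0).
  rewrite -[mass mu a `^ q](@mulr_powRB1 _ _ q) ?mass_ge0//.
  rewrite powRM ?mass_ge0 ?invr_ge0 ?hpi// powRV ?hpi// -powRN opprB.
  by ring.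
have A0 : 0 <= A by apply: sumr_ge0 => a _; exact: dual_mass_ge0.
have [->|An0] := eqVneq A 0; first by rewrite mulr_ge0 ?powR_ge0 ?mass_ge0.
have Ap : 0 < A by rewrite lt_neqAle eq_sym An0.
(* s below is a quotient by the mass of c; if that mass vanished, A would too *)
have mc : 0 < mass mu c.
  rewrite lt_neqAle mass_ge0 andbT eq_sym; apply: contraNneq An0 => mc0.
  rewrite /A big1_seq// => a /andP[_ aF].
  have : mass mu a <= mass mu c.
    have [ea ac] := Fc _ aF; rewrite -lee_fin -!massE//; apply: le_measure.
    - by rewrite inE; exact: measurable_shadow.
    - by rewrite inE; exact: measurable_shadow.
    - by move=> x xa; exact: geo_to_up ac.
  rewrite mc0 => ma; have ma0 : mass mu a = 0 by apply/eqP; rewrite eq_le ma mass_ge0.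
  by rewrite /dual_mass ma0 powR0// mulr0; case: ifP.
pose s := A / mass mu c; have sp : 0 < s by rewrite divr_gt0.
have sp1 : 0 < s `^ (p - 1) by rewrite powR_gt0.
pose f (y : R) := p * s `^ (p - 1) * y.
pose g (y : R) := y `^ p + (p - 1) * s `^ p * (0 < y)%R%:R.
have lf : layerable f.
  rewrite /f; split=> [|y z _ yz]; first by rewrite mulr0.
  by rewrite ler_wpM2l// mulr_ge0// ltW.
have lg : layerable g.
  rewrite /g; split=> [|y z y0 yz]; first by rewrite powR0// ltxx mulr0 addr0.
  apply: lerD; first exact: (layerable_powR hp).2.
  rewrite ler_wpM2l ?mulr_ge0 ?powR_ge0 ?(ltW p1)//.
  exact: (layerable_gt (lexx 0)).2.
have fg x : f (path_sum F phi x) <= g (path_sum F phi x).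
  have y0 := path_sum_ge0 phi0 x; move: (path_sum F phi x) y0 => y y0.
  have [->|yn0] := eqVneq y 0; first by rewrite lf.1 lg.1.
  have yp : 0 < y by rewrite lt_neqAle eq_sym yn0.
  rewrite /f /g yp mulr1; have := powR_tangent hp y0 (ltW sp); lra.
have := le_layer_sum uF eF phi0 mu_fin lf lg fg.
rewrite /f /g layer_sumZ layer_sumD layer_sumZ mE => h.
have hX := admissible_layer_sum mu_fin adm uF eF phi0; rewrite eE in hX.
have hm : layer_sum mu F phi (fun y => (0 < y)%R%:R) <= mass mu c.
  by apply: layer_sum_gt0_le => // b /Fc[].
have sE : s `^ p * mass mu c = s `^ (p - 1) * A.
  rewrite -(mulr_powRB1 (ltW sp) p0) [s * _]mulrC -mulrA; congr (_ * _).
  by rewrite /s divfK// gt_eqF.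
have {}hm : (p - 1) * s `^ p * layer_sum mu F phi (fun y => (0 < y)%R%:R)
    <= (p - 1) * (s `^ (p - 1) * A).
  by rewrite -sE -mulrA; apply: ler_wpM2l (ltW p1) _ _ _; rewrite ler_wpM2l ?powR_ge0.
have hs : s `^ (p - 1) <= C by rewrite -(ler_pM2r Ap); lra.
have hs' : s <= C `^ (p - 1)^-1.
  have -> : s = (s `^ (p - 1)) `^ (p - 1)^-1 by rewrite -powRrM mulfV// powRr1// ltW.
  by apply: ge0_ler_powR; rewrite ?nnegrE ?powR_ge0 ?invr_ge0 ?(ltW p1).
by rewrite -ler_pdivrMr.
Qed.

(** * The two-sided bounds *)

Lemma mass_energy_sup_ge0 : (0 <= mass_energy_sup p pi mu)%E.
Proof.
have [w ew hw] := root_shadow G; apply: le_ereal_sup_tmp; eexists; first by exists w.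
rewrite /equot; case: ifP => // _.
by rewrite mule_ge0 ?mass_energy_sum_ge0// inve_ge0.
Qed.

Lemma isocapacitary_ge0 : (0 <= isocapacitary_const p pi mu)%E.
Proof.
have [w ew hw] := root_shadow G; apply: le_ereal_sup_tmp; eexists.
  exists 0%N, (fun=> w); split=> //.
  by move=> i j _ _ _; rewrite (ord1 i) (ord1 j).
rewrite /equot; case: ifP => // _.
by rewrite mule_ge0 ?sume_ge0// inve_ge0 capacity_ge0.
Qed.

Lemma mass_energy_constE : (mass_energy_const p pi mu = mass_energy_sup p pi mu `^ (p - 1))%E.
Proof. by rewrite /mass_energy_const pconjB1V. Qed.

Lemma le_hardy_const (x : \bar R) :
  (forall C, 0 <= C -> admissible C -> (x <= C%:E)%E) -> (x <= hardy_const p pi mu)%E.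
Proof. by move=> h; apply: le_ereal_inf_tmp => _ [C [C0 adm] <-]; exact: h. Qed.

Lemma isocapacitary_hardy_bounds :
  (isocapacitary_const p pi mu <= hardy_const p pi mu)%E /\
  (hardy_const p pi mu <= (2 `^ p)%:E * isocapacitary_const p pi mu)%E.
Proof.
split.
  by apply: le_hardy_const => C; exact: isocapacitary_le_admissible.
have := isocapacitary_ge0; case E: isocapacitary_const => [M| |]// M0.
  by rewrite -EFinM; apply: hardy_le_isocapacitary; rewrite ?E.
by rewrite gt0_muley ?leey// lte_fin powR_gt0.
Qed.

Lemma mass_energy_hardy_bounds :
  (mass_energy_const p pi mu <= hardy_const p pi mu)%E /\
  (hardy_const p pi mu <= (p `^ p)%:E * mass_energy_const p pi mu)%E.
Proof.
rewrite mass_energy_constE; split.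
  apply: le_hardy_const => C C0 adm.
  have := ler_poweR p1 mass_energy_sup_ge0 (mass_energy_le C0 adm).
  by rewrite poweR_EFin -powRrM mulVf// powRr1.
have := mass_energy_sup_ge0; case E: mass_energy_sup => [K| |]// K0.
  rewrite poweR_EFin -EFinM; apply: hardy_const_le.
    by rewrite mulr_ge0 ?powR_ge0.
  by apply: mass_energy_admissible; rewrite ?E.
by rewrite poweRyr// gt0_muley ?leey// lte_fin powR_gt0.
Qed.

End Bounds.

Local Open Scope ereal_scope.

Theorem theorem2 (R : realType) (G : rootedTree) (p : R)
    (pi : {fset vert G} -> R) (mu : {measure set borel_Tbar G -> \bar R})
    (hp : (1 < p)%R) (hpi : forall a, edges a -> (0 <= pi a)%R) :
  (hardy_const p pi mu < +oo <-> mass_energy_sup p pi mu < +oo) /\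
  (hardy_const p pi mu < +oo <-> isocapacitary_const p pi mu < +oo) /\
  (isocapacitary_const p pi mu <= hardy_const p pi mu /\
   hardy_const p pi mu <= (2 `^ p)%:E * isocapacitary_const p pi mu) /\
  (mass_energy_const p pi mu <= hardy_const p pi mu /\
   hardy_const p pi mu <= (p `^ p)%:E * mass_energy_const p pi mu).
Proof.
have [iso_le le_iso] := isocapacitary_hardy_bounds mu hp hpi.
have [me_le le_me] := mass_energy_hardy_bounds mu hp hpi.
have p1 : (p - 1 != 0)%R by rewrite gt_eqF// subr_gt0.
have finZ (c : R) x : 0 <= x -> x < +oo -> c%:E * x < +oo.
  by case: x => // x _ _; rewrite -EFinM ltry.
do ![split=> //] => h.
- apply: (lty_poweRy p1); rewrite -mass_energy_constE//.
  exact: le_lt_trans me_le h.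
- apply: le_lt_trans le_me (finZ _ _ _ _); rewrite mass_energy_constE ?poweR_ge0//.
  exact: poweR_lty.
- exact: le_lt_trans iso_le h.
- by apply: le_lt_trans le_iso (finZ _ _ _ h); exact: isocapacitary_ge0.
Qed.
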